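(* Let $\sigma$ be a permutation of $[k]=\{1,\ldots,k\}$ and let $\mu=\mu_\sigma$ be the corresponding empirical permuton. Let $D_\sigma=\{\ell\in[k]:\mathrm{Inv}_\sigma(\ell)=\emptyset\}$ be the set of splittings of $\sigma$. Let $\mathcal{I}_n^\mu$ be the minimal inversion of $n$ i.i.d. points distributed according to $\mu$. Then, as $n\to\infty$: (i) if $D_\sigma\ne\emptyset$, then $n^{-1/2}\mathcal{I}_n^\mu$ converges in distribution to $\mathrm{Rayleigh}(2,\,k|D_\sigma|)$; in particular, when $\sigma$ is the identity, $n^{-1/2}\mathcal{I}_n^\mu$ converges in distribution to $\mathrm{Rayleigh}(2,k^2)$; (ii) if $D_\sigma=\emptyset$, then $n^{-1}\mathcal{I}_n^\mu$ converges in distribution (and also in probability) to $\frac1k\min\{|\mathrm{Inv}_\sigma(\ell)|:\ell\in[k]\}$; in particular, in this case, when $\sigma$ is the anti-identity $\ell\mapsto k+1-\ell$, $n^{-1}\mathcal{I}_n^\mu$ converges to $\frac{k-1}{k}$.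
   Context: A permuton is a probability measure on $[0,1]^2$ with uniform marginals. For a permutation $\sigma$ of $[k]$, the empirical permuton $\mu_\sigma$ is the permuton with density $f(x,y)=k$ if $\lceil ky\rceil=\sigma(\lceil kx\rceil)$ and $f(x,y)=0$ otherwise. For a permutation $\sigma$ of $[k]$, $\mathrm{Inv}_\sigma(\ell)=\{m\in[k]:(\ell-m)(\sigma(\ell)-\sigma(m))<0\}$. Minimal inversion: for i.i.d. points $(X_1,Y_1),\ldots,(X_n,Y_n)$ sampled from $\mu$, let $\mathrm{Inv}(i)=\{j:(X_i-X_j)(Y_i-Y_j)<0\}$ and $\mathcal{I}_n^\mu=\min\{|\mathrm{Inv}(i)|:1\le i\le n\}$. $\mathrm{Rayleigh}(a,b)$ is the law of a random variable $R$ on $[0,\infty)$ with $\mathbb{P}(R>t)=e^{-bt^a}$ for all $t\ge0$. *)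

(* Defs.v *)
From HB Require Import structures.
From mathcomp Require Import all_boot all_order all_algebra perm.
From mathcomp Require Import all_classical all_reals all_analysis measurable_realfun.

Set Implicit Arguments.
Unset Strict Implicit.
Unset Printing Implicit Defensive.

Import Order.TTheory GRing.Theory Num.Theory.
Import numFieldNormedType.Exports.

Local Open Scope classical_set_scope.
Local Open Scope ring_scope.

Definition inversions (K : realDomainType) (n : nat) (p : 'I_n -> K * K)
    (i : 'I_n) : {set 'I_n} :=
  [set j | ((p i).1 - (p j).1) * ((p i).2 - (p j).2) < 0]%SET.

(* The neutral value n plays no role when 0 < n, since every inversion set has
   at most n - 1 elements; for n = 0 the value is 0. *)
Definition min_inversion (K : realDomainType) (n : nat) (p : 'I_n -> K * K) :
    nat :=
  (\big[minn/n]_(i < n) #|inversions p i|)%N.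

(* Permutations act on 'I_k = {0, .., k - 1} instead of {1, .., k}; the shift of
   indices cancels in the differences defining the inversion sets. *)
Definition perm_points (k : nat) (s : 'S_k) (l : 'I_k) : int * int :=
  (l%:Z, (s l)%:Z).

Definition splittings (k : nat) (s : 'S_k) : {set 'I_k} :=
  [set l | inversions (perm_points s) l == finset.set0]%SET.

Definition anti_identity (k : nat) : 'S_k := perm (@rev_ord_inj k).

(* With 0-based indices, the cell of l : 'I_k is ]l / k, (l + 1) / k], where
   ceil (k x) = l + 1.  The density vanishes outside ]0, 1]^2. *)
Definition empirical_density (R : realType) (k : nat) (s : 'S_k) (z : R * R) :
    R :=
  if [exists l : 'I_k, (Num.ceil (k%:R * z.1) == l.+1%:Z)
                    && (Num.ceil (k%:R * z.2) == (s l).+1%:Z)]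
  then k%:R else 0.

Definition empirical_permuton (R : realType) (k : nat) (s : 'S_k)
    (A : set (R * R)) : \bar R :=
  (\int[lebesgue_measure \x lebesgue_measure]_(z in A)
     (empirical_density s z)%:E)%E.

(* The product rule for subfamilies is the case B i = setT outside of them. *)
Definition mutually_independent (R : realType) (d d' : measure_display)
    (T : measurableType d) (T' : measurableType d') (P : probability T R)
    (n : nat) (Z : 'I_n -> {RV P >-> T'}) : Prop :=
  forall B : 'I_n -> set T', (forall i, measurable (B i)) ->
    P (\bigcap_(i in [set: 'I_n]) (Z i @^-1` B i)) =
    (\prod_(i < n) P (Z i @^-1` B i))%E.

Definition iid_sample (R : realType) (d d' : measure_display)
    (T : measurableType d) (T' : measurableType d') (P : probability T R)
    (mu : set T' -> \bar R) (n : nat) (Z : 'I_n -> {RV P >-> T'}) : Prop :=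
  mutually_independent Z /\
  forall (i : 'I_n) (A : set T'), measurable A -> distribution P (Z i) A = mu A.

Section min_inversion_rv.
Context (R : realType) (d : measure_display) (T : measurableType d).
Context (P : probability T R) (n : nat).
Variable Z : 'I_n -> {RV P >-> (R * R)%type}.

Definition min_inversion_rv (w : T) : R :=
  (min_inversion (fun i => Z i w))%:R.

Let inv_pattern (w : T) : {ffun 'I_n * 'I_n -> bool} :=
  [ffun ij => ij.2 \in inversions (fun i => Z i w) ij.1].

Let measurable_inv_pattern (g : {ffun 'I_n * 'I_n -> bool}) :
  measurable (inv_pattern @^-1` [set g]).
Proof.
have -> : inv_pattern @^-1` [set g] = \bigcap_(ij in [set: 'I_n * 'I_n])
    ((fun w => (((Z ij.1 w).1 - (Z ij.2 w).1) *
                ((Z ij.1 w).2 - (Z ij.2 w).2) < 0) : bool) @^-1` [set g ij]).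
  apply/seteqP; split=> [w /= <- ij _ /=|w /= H]; first by rewrite ffunE inE.
  by apply/ffunP => ij; rewrite ffunE inE; apply: (H ij I).
apply: fin_bigcap_measurable => [|ij _]; first exact: finite_finset.
rewrite -[X in measurable X]setTI.
have mf : measurable_fun setT (fun w => (((Z ij.1 w).1 - (Z ij.2 w).1) *
                ((Z ij.1 w).2 - (Z ij.2 w).2) < 0) : bool).
  by apply: measurable_fun_ltr => //; apply: measurable_funM;
    apply: measurable_funB; apply: measurableT_comp.
by apply: mf.
Qed.

Lemma measurable_min_inversion_rv : measurable_fun [set: T] min_inversion_rv.
Proof.
pose F (g : {ffun 'I_n * 'I_n -> bool}) : R :=
  (\big[minn/n]_(i < n) #|[set j | g (i, j)]%SET|)%N%:R.
have E w : min_inversion_rv w = F (inv_pattern w).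
  rewrite /min_inversion_rv /F /min_inversion; congr (_%:R).
  apply: eq_bigr => i _; apply: eq_card => j.
  by rewrite [RHS]inE ffunE.
move=> _ B mB; rewrite setTI.
have -> : min_inversion_rv @^-1` B =
    \bigcup_(g in F @^-1` B) (inv_pattern @^-1` [set g]).
  apply/seteqP; split=> [w /= Bw|w [g /= Bg gE]].
    by exists (inv_pattern w) => //=; rewrite -E.
  by rewrite /= E gE.
by apply: fin_bigcup_measurable => [|g _]; [exact: finite_finset|].
Qed.

HB.instance Definition _ :=
  isMeasurableFun.Build _ _ _ _ min_inversion_rv measurable_min_inversion_rv.

End min_inversion_rv.

(* The probability spaces may vary with n. *)
Definition cvg_in_law (R : realType) (d : nat -> measure_display)
    (T : forall n, measurableType (d n)) (P : forall n, probability (T n) R)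
    (X : forall n, {RV (P n) >-> R}) (nu : probability R R) : Prop :=
  forall f : R -> R, continuous f -> bounded_fun f ->
    'E_(P n)[f \o X n]%E @[n --> \oo] --> (\int[nu]_x (f x)%:E)%E.

Definition cvg_in_probability (R : realType) (d : nat -> measure_display)
    (T : forall n, measurableType (d n)) (P : forall n, probability (T n) R)
    (X : forall n, {RV (P n) >-> R}) (c : R) : Prop :=
  forall e : R, 0 < e ->
    P n [set w | e < `|X n w - c|] @[n --> \oo] --> 0%E.

(* These tails determine nu. *)
Definition is_rayleigh (R : realType) (a b : R) (nu : probability R R) : Prop :=
  nu `[0, +oo[%classic = 1%E /\
  forall t : R, 0 <= t -> nu `]t, +oo[%classic = (expR (- (b * t `^ a)))%:E.

(* Main.v *)
(* Cut the cell of each l into n x n boxes.  All k n^2 boxes have the same mass,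
   so the box labels of the sample are uniform on words of length n and every
   probability below is a proportion of words.  The number of inversions of a
   point lies between the numbers of other points in the boxes surely,
   respectively possibly, inverted with its own box; conditionally on that box
   these are binomial variables, so an exponential Markov inequality and a union
   bound over the points pin all n inversion counts simultaneously, up to an
   error n exp(- c sqrt n).
   A point at local position (u, v) in [0, 1]^2 of the cell of l has about
   (n / k) (#Inv(l) + u + v - 2 u v) inversions.  Without splittings the minimum
   over the points is therefore (n / k) min #Inv(l).  With splittings the minimum
   exceeds t sqrt n when no point falls into the 2 #D triangles of side
   t k / sqrt n at the corners (0, 0) and (1, 1) of the splitting cells; their
   total mass is k #D t^2 / n, whence the limit exp(- k #D t^2). *)
Require Import Defs.
From HB Require Import structures.
From mathcomp Require Import all_boot all_order all_algebra perm.
From mathcomp Require Import all_classical all_reals all_analysis measurable_realfun.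
From mathcomp Require Import ring lra zify.
Import Order.TTheory GRing.Theory Num.Theory.
Import numFieldNormedType.Exports.
Local Open Scope classical_set_scope.
Local Open Scope ring_scope.
Set Implicit Arguments.
Unset Strict Implicit.
Unset Printing Implicit Defensive.

(** * Uniform words over a finite alphabet *)

(** Only one comparison between samples and words is needed: a probability is at most a proportion
    of words. It suffices because a tail event and its complement are both bounded from above. The
    grid is refined with n because the boxes on a border row or column of a box are undecided. Such
    a strip inside a cell has mass 1 / (k n) and holds O(1) sample points on average, which is
    negligible against sqrt n. The inversion counts of different points are dependent, but the union
    bound only uses each count given its own box. Summing over that box is free, since every box has
    probability 1 / (k n^2). The exponential bound needs a strict gap between the expected count and
    the threshold. In case (i) the estimate is made at a parameter next to t, and continuity of
    exp(- k #D t^2) closes the gap; in case (ii) the tolerance of convergence in probability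
    provides it. *)

Definition freq (R : realType) (T : finType) (A : {set T}) : R :=
  #|A|%:R / #|T|%:R.

Lemma freq_ge0 (R : realType) (T : finType) (A : {set T}) : 0 <= freq R A.
Proof. by rewrite divr_ge0. Qed.

Lemma freq_le1 (R : realType) (T : finType) (A : {set T}) : freq R A <= 1.
Proof.
have [T0|T0] := eqVneq #|T| 0%N; first by rewrite /freq T0 invr0 mulr0.
by rewrite ler_pdivrMr ?ltr0n ?lt0n// mul1r ler_nat max_card.
Qed.

Lemma freq_subset (R : realType) (T : finType) (A B : {set T}) :
  A \subset B -> freq R A <= freq R B.
Proof.
by move=> AB; rewrite ler_wpM2r ?invr_ge0// ler_nat subset_leq_card.
Qed.

Lemma freq_setU (R : realType) (T : finType) (A B : {set T}) :
  freq R (A :|: B)%SET <= freq R A + freq R B.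
Proof.
by rewrite -mulrDl ler_wpM2r ?invr_ge0// -natrD ler_nat cardsU leq_subr.
Qed.

Lemma freq_setC (R : realType) (T : finType) (A : {set T}) :
  (0 < #|T|)%N -> freq R (~: A)%SET = 1 - freq R A.
Proof.
move=> T0; have T0' : (#|T|%:R : R) != 0 by rewrite pnatr_eq0 -lt0n.
by rewrite /freq cardsCs finset.setCK natrB ?max_card// mulrBl divff.
Qed.

Lemma freq_bigcup (R : realType) (T I : finType) (Q : pred I)
    (A : I -> {set T}) :
  freq R (\bigcup_(i | Q i) A i)%SET <= \sum_(i | Q i) freq R (A i).
Proof.
elim/big_ind2 : _ => [|B x C y Bx Cy|//]; first by rewrite /freq cards0 mul0r.
by apply: (le_trans (freq_setU _ _ _)); apply: lerD.
Qed.

Lemma freq_avoid (R : realType) (F : finType) (n : nat) (A : {set F}) :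
  (0 < #|F|)%N ->
  freq R [set w : {ffun 'I_n -> F} | [forall i, w i \notin A]]%SET =
  (1 - freq R A) ^+ n.
Proof.
move=> F0; rewrite -freq_setC// /freq expr_div_n -!natrX card_ffun card_ord.
congr (_%:R / _); rewrite -[in RHS](card_ord n) -card_ffun_on.
apply: eq_card => w; rewrite inE; apply/forallP/ffun_onP => H i.
  by rewrite inE; apply: H.
by have := H i; rewrite inE.
Qed.

(** Position [i] is left out so that, once [w i] is fixed, the count is binomial with n - 1
    trials. *)
Definition hits (n : nat) (F : finType) (w : {ffun 'I_n -> F}) (i : 'I_n)
    (S : {set F}) : nat :=
  #|[set j | (j != i) && (w j \in S)]%SET|.

(** The weight is a product over positions, so the sum over words factorises. The factor of position
    [i] is an indicator that pins its letter to [phi]; the n - 1 others are equal. Up to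
    normalisation this is the exponential moment of a binomial variable. *)
Lemma sum_expR_hits (R : realType) (n : nat) (F : finType) (i : 'I_n) (phi : F)
    (S : {set F}) (x : R) :
  \sum_(w : {ffun 'I_n -> F} | w i == phi) expR (x * (hits w i S)%:R) =
  (#|F|%:R + (expR x - 1) * #|S|%:R) ^+ n.-1.
Proof.
pose f (j : 'I_n) (y : F) : R :=
  if j == i then (y == phi)%:R else if y \in S then expR x else 1.
have : \prod_(j < n) \sum_y f j y =
    \sum_(w : {ffun 'I_n -> F}) \prod_(j < n) f j (w j).
  by rewrite bigA_distr_bigA.
rewrite (bigD1 i)//= (eq_bigr (fun y => (y == phi)%:R)); last first.
  by move=> y _; rewrite /f eqxx.
rewrite [X in X * _](bigD1 phi)//= eqxx [X in 1 + X]big1 ?addr0 ?mul1r; last first.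
  by move=> y /negbTE->.
rewrite (eq_bigr (fun=> #|F|%:R + (expR x - 1) * #|S|%:R)); last first.
  move=> j /negbTE ji; rewrite {}/f ji.
  rewrite (eq_bigr (fun y => 1 + (expR x - 1) * (y \in S)%:R)); last first.
    by move=> y _; case: ifP => _; rewrite ?mulr1 ?mulr0 ?addr0//; ring.
  rewrite big_split/= sumr_const -mulr_sumr; congr (_ + _ * _).
  by rewrite -sum1_card natr_sum [RHS]big_mkcond/=; apply: eq_bigr => y _; case: ifP.
rewrite prodr_const.
have -> : #|[pred j | j != i]| = n.-1 by rewrite cardC1 card_ord.
move=> ->; rewrite [RHS](bigID (fun w : {ffun 'I_n -> F} => w i == phi))/=.
rewrite [X in _ = _ + X]big1 ?addr0; last first.
  by move=> w /negbTE wi; rewrite (bigD1 i)//= {1}/f eqxx wi mul0r.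
apply: eq_bigr => w wi.
rewrite (bigD1 i)//= {1}/f eqxx wi mul1r /hits -sum1dep_card natr_sum.
rewrite big_mkcondr/= mulr_sumr expR_sum; apply: eq_bigr => j /negbTE ji.
by rewrite /f ji; case: ifP => _; rewrite ?mulr1// mulr0 expR0.
Qed.

(* The weight [exp (x (hits - a))] dominates the indicator of the event. *)
Lemma chernoff (R : realType) (n : nat) (F : finType) (i : 'I_n) (phi : F)
    (S : {set F}) (x a : R) :
  freq R [set w : {ffun 'I_n -> F} |
     (w i == phi) && (x * a <= x * (hits w i S)%:R)]%SET <=
  #|F|%:R^-1 * expR (- (x * a) + (expR x - 1) * (freq R S * n.-1%:R)).
Proof.
have F0 : 0 < #|F|%:R :> R by rewrite ltr0n; apply/card_gt0P; exists phi.
have n0 : (0 < n)%N by apply: leq_ltn_trans (ltn_ord i).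
rewrite /freq card_ffun card_ord natrX ler_pdivrMr ?exprn_gt0//.
have -> : #|F|%:R ^+ n = #|F|%:R * #|F|%:R ^+ n.-1 :> R.
  by rewrite -exprS prednK.
rewrite mulrACA mulVf ?gt_eqF// mul1r.
apply: (@le_trans _ _ (\sum_(w : {ffun 'I_n -> F} | w i == phi)
    expR (- (x * a)) * expR (x * (hits w i S)%:R))).
  rewrite -sum1_card natr_sum [leRHS](bigID
    (fun w : {ffun 'I_n -> F} => x * a <= x * (hits w i S)%:R))/=.
  rewrite -[leLHS]addr0 lerD//; last first.
    by apply: sumr_ge0 => w _; rewrite mulr_ge0 ?expR_ge0.
  under eq_bigl do rewrite inE.
  apply: ler_sum => w /andP[_ le].
  by rewrite -expRD; apply: le_trans (expR_ge1Dx _); lra.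
rewrite -mulr_sumr sum_expR_hits expRD -mulrA ler_wpM2l ?expR_ge0//.
set q := #|S|%:R; have -> : #|F|%:R + (expR x - 1) * q =
    (1 + (expR x - 1) * (q / #|F|%:R)) * #|F|%:R.
  by field; rewrite gt_eqF.
rewrite exprMn ler_wpM2r ?exprn_ge0 ?(ltW F0)//.
rewrite (mulrA _ (q / _)) expRM_natr.
rewrite lerXn2r ?nnegrE ?expR_ge0 ?expR_ge1Dx//.
(* What remains is that the base of the power is nonnegative: it is the convex combination (1 - q')
   + q' exp x with q' the proportion of [S]. *)
have q1 : q / #|F|%:R <= 1 by exact: freq_le1.
have q0 : 0 <= q / #|F|%:R by exact: freq_ge0.
have := expR_ge0 x; nra.
Qed.

(** [chernoff] at x = - e, with exp(- e) <= 1 / (1 + e), gives the rate e (s / (1 + e) - t),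
    positive once t (1 + e) < s. The rate depends on [s] and [t] only, hence is uniform over
    positions, letters and n; [r] is the scale, later sqrt n or n. *)
Lemma chernoff_lower (R : realType) (s t : R) : 0 <= s -> t < s ->
  exists2 c : R, 0 < c & forall (n : nat) (F : finType) (i : 'I_n) (phi : F)
    (S : {set F}) (r : R), 0 <= r -> s * r <= freq R S * n.-1%:R ->
  freq R [set w : {ffun 'I_n -> F} |
     (w i == phi) && ((hits w i S)%:R <= t * r)]%SET <=
  #|F|%:R^-1 * expR (- (c * r)).
Proof.
(* The denominator makes t e at most (s - t) / 2; the absolute value and the 1 keep it positive when
   t is negative or zero. *)
move=> s0 ts; pose e := (s - t) / (2 * (`|t| + 1)).
have t1 : 0 < 2 * (`|t| + 1) by have := normr_ge0 t; lra.
have e0 : 0 < e by rewrite divr_gt0// subr_gt0.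
have ete : t * (1 + e) < s.
  have : t * e <= (s - t) / 2.
    apply: (@le_trans _ _ (`|t| * e)); first by rewrite ler_wpM2r ?ler_norm ?ltW.
    have -> : (s - t) / 2 = (`|t| + 1) * e by rewrite /e; field; lra.
    by rewrite ler_wpM2r ?ltW//; lra.
  by move=> ?; lra.
have e1 : 0 < 1 + e by lra.
exists (e * (s / (1 + e) - t)).
  by rewrite mulr_gt0// subr_gt0 ltr_pdivlMr.
move=> n F i phi S r r0 sr.
have -> : [set w : {ffun 'I_n -> F} |
     (w i == phi) && ((hits w i S)%:R <= t * r)]%SET =
    [set w : {ffun 'I_n -> F} | (w i == phi) && (- e * (t * r) <= - e * (hits w i S)%:R)]%SET.
  by apply/setP => w; rewrite !inE !mulNr lerN2 ler_pM2l.
apply: (le_trans (chernoff _ _ _ _ _)).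
rewrite ler_wpM2l ?invr_ge0// ler_expR.
have E : expR (- e) <= (1 + e)^-1.
  by rewrite expRN lef_pV2 ?posrE ?expR_gt0// expR_ge1Dx.
have E1 : expR (- e) - 1 <= - (e / (1 + e)).
  have -> : - (e / (1 + e)) = (1 + e)^-1 - 1 by field; lra.
  by rewrite lerD2r.
have -> : - (e * (s / (1 + e) - t) * r) =
    - (- e * (t * r)) + - (e / (1 + e)) * (s * r) by field; lra.
rewrite lerD2l; apply: (@le_trans _ _ ((expR (- e) - 1) * (s * r))).
  by rewrite ler_wnM2l// subr_le0 -expR0 ler_expR; lra.
by rewrite ler_wpM2r// mulr_ge0.
Qed.

(** [chernoff] at x = e, with exp e <= 1 / (1 - e); the choice of e puts t (1 - e) halfway between s
    and t. *)
Lemma chernoff_upper (R : realType) (s t : R) : 0 <= s -> s < t ->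
  exists2 c : R, 0 < c & forall (n : nat) (F : finType) (i : 'I_n) (phi : F)
    (S : {set F}) (r : R), 0 <= r -> freq R S * n.-1%:R <= s * r ->
  freq R [set w : {ffun 'I_n -> F} |
     (w i == phi) && (t * r <= (hits w i S)%:R)]%SET <=
  #|F|%:R^-1 * expR (- (c * r)).
Proof.
move=> s0 st; have t0 : 0 < t by lra.
pose e := (t - s) / (2 * t).
have e0 : 0 < e by rewrite divr_gt0//; lra.
have te : t * e = (t - s) / 2 by rewrite /e; field; lra.
have e1 : 0 < 1 - e by rewrite -(pmulr_rgt0 _ t0); lra.
exists (e * (t - s / (1 - e))).
  by rewrite mulr_gt0// subr_gt0 ltr_pdivrMr//; lra.
move=> n F i phi S r r0 sr.
have -> : [set w : {ffun 'I_n -> F} |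
     (w i == phi) && (t * r <= (hits w i S)%:R)]%SET =
    [set w : {ffun 'I_n -> F} | (w i == phi) && (e * (t * r) <= e * (hits w i S)%:R)]%SET.
  by apply/setP => w; rewrite !inE ler_pM2l.
apply: (le_trans (chernoff _ _ _ _ _)).
rewrite ler_wpM2l ?invr_ge0// ler_expR.
have E : expR e <= (1 - e)^-1.
  by rewrite -[expR e]invrK -expRN lef_pV2 ?posrE ?expR_gt0// expR_ge1Dx.
have E1 : expR e - 1 <= e / (1 - e).
  have -> : e / (1 - e) = (1 - e)^-1 - 1 by field; lra.
  by rewrite lerD2r.
have -> : - (e * (t - s / (1 - e)) * r) =
    - (e * (t * r)) + e / (1 - e) * (s * r) by field; lra.
rewrite lerD2l; apply: (@le_trans _ _ ((expR e - 1) * (s * r))).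
  by rewrite ler_wpM2l// subr_ge0 -expR0 ler_expR; lra.
by rewrite ler_wpM2r// mulr_ge0.
Qed.

(** The factor 1 / #F in the hypothesis pays for the union over letters, so only the n positions are
    charged. *)
Lemma freq_exists_le (R : realType) (n : nat) (F : finType) (A : {set F})
    (Q : {ffun 'I_n -> F} -> 'I_n -> F -> bool) (b : R) : 0 <= b ->
  (forall i phi, phi \in A -> freq R [set w : {ffun 'I_n -> F} |
     (w i == phi) && Q w i phi]%SET <= #|F|%:R^-1 * b) ->
  freq R [set w : {ffun 'I_n -> F} |
    [exists i, (w i \in A) && Q w i (w i)]]%SET <= n%:R * b.
Proof.
move=> b0 H; apply: (@le_trans _ _ (freq R (\bigcup_(i < n) \bigcup_(phi in A)
    [set w : {ffun 'I_n -> F} | (w i == phi) && Q w i phi])%SET)).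
  apply: freq_subset; apply/fintype.subsetP => w; rewrite inE => /existsP[i /andP[wA Qw]].
  apply/bigcupP; exists i => //; apply/bigcupP; exists (w i) => //.
  by rewrite inE eqxx.
apply: (le_trans (freq_bigcup _ _ _)).
rewrite -[n in leRHS]card_ord -sumr_const mulr_suml.
apply: ler_sum => i _; apply: (le_trans (freq_bigcup _ _ _)).
apply: (@le_trans _ _ (\sum_(phi in A) #|F|%:R^-1 * b)).
  by apply: ler_sum => phi; apply: H.
rewrite sumr_const mul1r -[leLHS]mulr_natl mulrA ler_piMl//.
exact: freq_le1.
Qed.

(** * Boxes and inversions *)

Lemma subr_mul_lt0 (K : realDomainType) (x x' y y' : K) :
  ((x - x') * (y - y') < 0) =
  ((x < x') && (y' < y) || (x' < x) && (y < y')).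
Proof.
rewrite mulr_lt0 !subr_eq0 !subr_lt0.
by case: (ltgtP x x'); case: (ltgtP y y').
Qed.

Lemma mem_inversions (K : realDomainType) (n : nat) (p : 'I_n -> K * K)
    (i j : 'I_n) :
  (j \in inversions p i) =
  (((p i).1 < (p j).1) && ((p j).2 < (p i).2) ||
   ((p j).1 < (p i).1) && ((p i).2 < (p j).2)).
Proof. by rewrite inE subr_mul_lt0. Qed.

Lemma mem_inversions_perm (k : nat) (s : 'S_k) (l m : 'I_k) :
  (m \in inversions (perm_points s) l) =
  ((l < m)%N && (s m < s l)%N || (m < l)%N && (s l < s m)%N).
Proof. by rewrite mem_inversions. Qed.

Lemma min_inversion_le (K : realDomainType) (n : nat) (p : 'I_n -> K * K)
    (i : 'I_n) : (min_inversion p <= #|inversions p i|)%N.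
Proof.
rewrite /min_inversion; have := mem_index_enum i.
elim: (index_enum _) => // j r IH; rewrite inE big_cons geq_min.
by case/predU1P => [->|/IH->]; rewrite ?leqnn ?orbT.
Qed.

Lemma min_inversion_attained (K : realDomainType) (n : nat)
    (p : 'I_n -> K * K) : (0 < n)%N ->
  exists i, min_inversion p = #|inversions p i|.
Proof.
case: n p => // n p _.
case: (arg_minnP (fun i => #|inversions p i|) (isT : xpredT (@ord0 n))) => i _ H.
exists i; apply/eqP; rewrite eqn_leq min_inversion_le/=.
rewrite /min_inversion; elim/big_ind : _ => [|x y xi yi|j _].
(* The neutral value of the minimum is harmless: no set of indices has more elements than there are
   indices. *)
- by rewrite -[in leqRHS](card_ord n.+1) max_card.
- by rewrite leq_min xi.
- exact: H.
Qed.

(* The box [(l, a, b)] is the subsquare with column [a] and row [b] in the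
   n x n subdivision of the cell of [l]; its sides have length 1 / (k n). *)
Definition box (k n : nat) : finType := ('I_k * 'I_n * 'I_n)%type.

Definition box_col (k n : nat) (f : box k n) : nat := f.1.1 * n + f.1.2.

Definition box_row (k n : nat) (s : 'S_k) (f : box k n) : nat :=
  s f.1.1 * n + f.2.

(* Boxes all of whose points are inverted with all points of [f]. *)
Definition inner_inv (k n : nat) (s : 'S_k) (f : box k n) : {set box k n} :=
  [set g | (box_col f < box_col g)%N && (box_row s g < box_row s f)%N ||
           (box_col g < box_col f)%N && (box_row s f < box_row s g)%N]%SET.

(* Boxes some point of which may be inverted with some point of [f]. *)
Definition outer_inv (k n : nat) (s : 'S_k) (f : box k n) : {set box k n} :=
  [set g | ~~ ((box_col f < box_col g)%N && (box_row s f < box_row s g)%N ||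
           (box_col g < box_col f)%N && (box_row s g < box_row s f)%N)]%SET.

Lemma ltn_digits (n a b x y : nat) : (x < n)%N -> (y < n)%N ->
  (a * n + x < b * n + y)%N = ((a < b) || (a == b) && (x < y))%N.
Proof.
move=> xn yn; case: (ltngtP a b) => [ab|ba|->]; last by rewrite ltn_add2l.
- have : (a.+1 * n <= b * n)%N by rewrite leq_mul2r ab orbT.
  by rewrite mulSn; lia.
- have : (b.+1 * n <= a * n)%N by rewrite leq_mul2r ba orbT.
  by rewrite mulSn; lia.
Qed.

Lemma ltn_box_col (k n : nat) (f g : box k n) :
  (box_col f < box_col g)%N =
  ((f.1.1 < g.1.1) || (f.1.1 == g.1.1) && (f.1.2 < g.1.2))%N.
Proof. by rewrite ltn_digits. Qed.

Lemma ltn_box_row (k n : nat) (s : 'S_k) (f g : box k n) :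
  (box_row s f < box_row s g)%N =
  ((s f.1.1 < s g.1.1) || (f.1.1 == g.1.1) && (f.2 < g.2))%N.
Proof. by rewrite ltn_digits// -(inj_eq (@perm_inj _ s)). Qed.

Lemma card_ord_ltn (n m : nat) : (m <= n)%N ->
  #|[set i : 'I_n | (i < m)%N]%SET| = m.
Proof.
move=> mn; rewrite -sum1dep_card (big_ord_narrow mn) sum1_card.
by rewrite card_ord.
Qed.

Lemma card_ord_gtn (n m : nat) : (m < n)%N ->
  #|[set i : 'I_n | (m < i)%N]%SET| = (n.-1 - m)%N.
Proof.
move=> mn; have -> : [set i : 'I_n | (m < i)%N]%SET =
    (~: [set i : 'I_n | (i < m.+1)%N])%SET.
  by apply/setP => i; rewrite !inE ltnS -ltnNge.
by rewrite cardsCs finset.setCK card_ord card_ord_ltn//; lia.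
Qed.

Lemma leq_card_disjoint (T : finType) (A B C : {set T}) :
  A \subset C -> B \subset C -> {in A, forall x, x \notin B} ->
  (#|A| + #|B| <= #|C|)%N.
Proof.
move=> AC BC AB; rewrite -cardsUI.
have -> : (A :&: B = finset.set0)%SET.
  by apply/setP => x; rewrite !inE; apply/negP => /andP[/AB/negP].
rewrite cards0 addn0.
by rewrite subset_leq_card// finset.subUset AC.
Qed.

(** Three disjoint families are counted: all boxes of the cells inverted with that of [f], and, in
    the cell of [f], the rectangles strictly to the upper left and strictly to the lower right. *)
Lemma card_inner_inv (k n : nat) (s : 'S_k) (f : box k n) :
  (#|inversions (perm_points s) f.1.1| * n ^ 2 +
   (f.1.2 * (n.-1 - f.2) + (n.-1 - f.1.2) * f.2) <= #|inner_inv s f|)%N.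
Proof.
case: f => [[l a] b] /=; set I := inversions _ l.
pose A : {set box k n} := finset.setX (finset.setX I [set: 'I_n]%SET) [set: 'I_n]%SET.
pose B : {set box k n} :=
  finset.setX (finset.setX [set l]%SET [set i : 'I_n | (i < a)%N]%SET)
    [set j : 'I_n | (b < j)%N]%SET.
pose C : {set box k n} :=
  finset.setX (finset.setX [set l]%SET [set i : 'I_n | (a < i)%N]%SET)
    [set j : 'I_n | (j < b)%N]%SET.
have lI : l \notin I by rewrite mem_inversions_perm !ltnn.
have cA : #|A| = (#|I| * n ^ 2)%N.
  by rewrite !cardsX !cardsT card_ord; ring.
have cB : #|B| = (a * (n.-1 - b))%N.
  by rewrite !cardsX cards1 mul1n card_ord_ltn 1?ltnW// card_ord_gtn.
have cC : #|C| = ((n.-1 - a) * b)%N.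
  by rewrite !cardsX cards1 mul1n card_ord_gtn// card_ord_ltn 1?ltnW.
rewrite -cA -cB -cC.
have sub g : (g \in A) || ((g \in B) || (g \in C)) -> g \in inner_inv s (l, a, b).
  case: g => [[l' a'] b']; rewrite !inE/= !andbT subr_mul_lt0/=.
  rewrite !ltn_box_col !ltn_box_row/=.
  by case: (eqVneq l l') => [<-|]; case: (ltngtP l l'); rewrite ?ltnn ?eqxx;
    try lia.
apply: leq_trans (@leq_card_disjoint _ A (B :|: C)%SET _ _ _ _).
- rewrite leq_add2l; apply: leq_card_disjoint;
    rewrite ?finset.subsetUl ?finset.subsetUr//.
  by move=> [[l' a'] b']; rewrite !inE; lia.
- by apply/fintype.subsetP => g gA; apply: sub; rewrite gA.
- by apply/fintype.subsetP => g; rewrite inE => gA; apply: sub; rewrite gA orbT.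
- move=> [[l' a'] b'].
  rewrite finset.in_setX finset.in_setX/= => /andP[/andP[/= l'I _] _].
  rewrite !inE/=.
  by case: eqVneq l'I => // ->; rewrite (negbTE lI).
Qed.

(** Distinct cells differ in both coordinates, so outside the cell of [f] only inverted cells
    contribute. Inside it, a box must miss the open upper right quadrant of [f], which confines it
    to a + 1 columns or b + 1 rows; missing the lower left quadrant gives n - a columns or n - b
    rows. Each bound is sharp enough near one of the two corners. *)
Lemma card_outer_inv (k n : nat) (s : 'S_k) (f : box k n) :
  (#|outer_inv s f| <= #|inversions (perm_points s) f.1.1| * n ^ 2 +
   n * minn (f.1.2 + f.2 + 2) (n - f.1.2 + (n - f.2)))%N.
Proof.
case: f => [[l a] b] /=; set I := inversions _ l.
pose A : {set box k n} := finset.setX (finset.setX I [set: 'I_n]%SET) [set: 'I_n]%SET.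
pose X (B C : {set 'I_n}) : {set box k n} :=
  (finset.setX (finset.setX [set l]%SET B) [set: 'I_n]%SET :|:
   finset.setX (finset.setX [set l]%SET [set: 'I_n]%SET) C)%SET.
have cA : #|A| = (#|I| * n ^ 2)%N.
  by rewrite !cardsX !cardsT card_ord; ring.
have cX B C : (#|X B C| <= n * (#|B| + #|C|))%N.
  apply: (leq_trans (leq_card_setU _ _).1).
  by rewrite !cardsX cardsT cards1 card_ord !mul1n mulnDr mulnC.
have sub (B C : {set 'I_n}) :
    (forall a' b' : 'I_n, (a', b') \in
       [set g : 'I_n * 'I_n | ~~ ((a < g.1)%N && (b < g.2)%N ||
                               (g.1 < a)%N && (g.2 < b)%N)]%SET ->
       (a' \in B) || (b' \in C)) ->
    (#|outer_inv s (l, a, b)| <= #|A| + n * (#|B| + #|C|))%N.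
  move=> H; apply: (@leq_trans #|A :|: X B C|%SET); last first.
    apply: (leq_trans (leq_card_setU _ _).1).
    by rewrite leq_add2l; apply: cX.
  apply: subset_leq_card; apply/fintype.subsetP => -[[l' a'] b'].
  rewrite !inE/= !andbT subr_mul_lt0/= !ltn_box_col !ltn_box_row/=.
  have := H a' b'; rewrite inE/=.
  case: (eqVneq l l') => [<- Hab|ll' _].
    by rewrite !ltnn/= => ab; apply/orP; right; apply: Hab.
  have : s l != s l' :> nat by rewrite (inj_eq val_inj) (inj_eq (@perm_inj _ s)).
  by move: ll'; rewrite -(inj_eq val_inj)/= eq_sym; lia.
rewrite -cA; case: (leqP (a + b + 2) (n - a + (n - b))) => _.
- have H : (#|outer_inv s (l, a, b)| <= #|A| + n * (a.+1 + b.+1))%N.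
    have := sub [set i : 'I_n | (i < a.+1)%N]%SET [set i : 'I_n | (i < b.+1)%N]%SET.
    rewrite !card_ord_ltn//; apply=> a' b'; rewrite !inE/=; lia.
  by apply: (leq_trans H); rewrite addSn addnS addn2.
- have := sub (~: [set i : 'I_n | (i < a)%N])%SET (~: [set i : 'I_n | (i < b)%N])%SET.
  have cC (m : 'I_n) : #|~: [set i : 'I_n | (i < m)%N]%SET| = (n - m)%N.
    by rewrite cardsCs finset.setCK card_ord card_ord_ltn// ltnW.
  rewrite !cC; apply=> a' b'.
  by rewrite !inE/=; lia.
Qed.

(** The half-open convention is that of [empirical_density]; it makes the boxes disjoint and turns
    strict order of columns or rows into strict order of coordinates. *)
Definition in_box (R : realType) (k n : nat) (s : 'S_k) (f : box k n) :
    set (R * R) :=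
  [set z | (Num.ceil ((k * n)%:R * z.1) == (box_col f).+1%:Z) &&
           (Num.ceil ((k * n)%:R * z.2) == (box_row s f).+1%:Z)].

Lemma ceil_eqE (R : realType) (x : R) (m : nat) :
  (Num.ceil x == m.+1%:Z) = (m%:R < x <= m.+1%:R).
Proof. by rewrite ceil_eq -addn1 PoszD addrK !pmulrn. Qed.

Lemma ceil_lt_mono (R : realType) (N x y : R) : 0 <= N ->
  Num.ceil (N * x) < Num.ceil (N * y) -> x < y.
Proof.
move=> N0; rewrite !ltNge; apply: contra => yx.
by apply: ceil_le; apply: ler_wpM2l.
Qed.

Lemma in_box_col (R : realType) (k n : nat) (s : 'S_k) (f g : box k n)
    (z z' : R * R) : in_box s f z -> in_box s g z' ->
  (box_col f < box_col g)%N -> z.1 < z'.1.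
Proof.
move=> /andP[/eqP zf _] /andP[/eqP zg _] fg.
by apply: (@ceil_lt_mono _ (k * n)%:R) => //; rewrite zf zg ltz_nat.
Qed.

Lemma in_box_row (R : realType) (k n : nat) (s : 'S_k) (f g : box k n)
    (z z' : R * R) : in_box s f z -> in_box s g z' ->
  (box_row s f < box_row s g)%N -> z.2 < z'.2.
Proof.
move=> /andP[_ /eqP zf] /andP[_ /eqP zg] fg.
by apply: (@ceil_lt_mono _ (k * n)%:R) => //; rewrite zf zg ltz_nat.
Qed.

Lemma hits_inner_inv (R : realType) (k n : nat) (s : 'S_k)
    (p : 'I_n -> R * R) (w : {ffun 'I_n -> box k n}) (i : 'I_n) :
  (forall i, in_box s (w i) (p i)) ->
  (hits w i (inner_inv s (w i)) <= #|inversions p i|)%N.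
Proof.
move=> pw; apply: subset_leq_card; apply/fintype.subsetP => j.
rewrite mem_inversions inE inE => /andP[_ /orP[]/andP[c r]]; apply/orP;
  [left|right]; by rewrite (in_box_col (pw _) (pw _) c) (in_box_row (pw _) (pw _) r).
Qed.

Lemma hits_outer_inv (R : realType) (k n : nat) (s : 'S_k)
    (p : 'I_n -> R * R) (w : {ffun 'I_n -> box k n}) (i : 'I_n) :
  (forall i, in_box s (w i) (p i)) ->
  (#|inversions p i| <= hits w i (outer_inv s (w i)))%N.
Proof.
move=> pw; apply: subset_leq_card; apply/fintype.subsetP => j.
rewrite mem_inversions !inE => H; apply/andP; split.
  (* A point is not inverted with itself, so leaving [i] out of [hits] loses nothing. *)
  by apply: contraTN H => /eqP ->; rewrite !ltxx.
apply: contraTN H => /orP[]/andP[c r].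
  have := in_box_col (pw _) (pw _) c; have := in_box_row (pw _) (pw _) r.
  by move=> /ltW y /ltW x; rewrite !ltNge x y/= ?andbF.
have := in_box_col (pw _) (pw _) c; have := in_box_row (pw _) (pw _) r.
by move=> /ltW y /ltW x; rewrite !ltNge x y/= ?andbF.
Qed.

Lemma freq_inner_inv (R : realType) (k n : nat) (s : 'S_k) (f : box k n) :
  #|inversions (perm_points s) f.1.1|%:R / k%:R +
  (f.1.2%:R * (n%:R - 1 - f.2%:R) + (n%:R - 1 - f.1.2%:R) * f.2%:R) /
    (k%:R * n%:R ^+ 2) <= freq R (inner_inv s f).
Proof.
case: f => [[l a] b] /=.
have k0 : (0 < k)%N by apply: leq_ltn_trans (ltn_ord l).
have n0 : (0 < n)%N by apply: leq_ltn_trans (ltn_ord a).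
have kn0 : 0 < k%:R * n%:R ^+ 2 :> R by rewrite mulr_gt0 ?exprn_gt0 ?ltr0n.
have bE (c : 'I_n) : n%:R - 1 - c%:R = (n.-1 - c)%:R :> R.
  have -> : n%:R = n.-1%:R + 1 :> R by rewrite natr1 prednK.
  by rewrite natrB ?addrK//; have := ltn_ord c; lia.
have -> : forall x : R, x / k%:R = (x * n%:R ^+ 2) / (k%:R * n%:R ^+ 2).
  by move=> x; field; rewrite !pnatr_eq0 -!lt0n n0.
rewrite -mulrDl !bE /freq.
have -> : #|{: box k n}|%:R = k%:R * n%:R ^+ 2 :> R.
  by rewrite !card_prod !card_ord -mulnA natrM natrM.
rewrite ler_pM2r ?invr_gt0// -!natrX -!natrM -!natrD ler_nat.
exact: (card_inner_inv s (l, a, b)).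
Qed.

Lemma freq_outer_inv (R : realType) (k n : nat) (s : 'S_k) (f : box k n) :
  freq R (outer_inv s f) <= #|inversions (perm_points s) f.1.1|%:R / k%:R +
  (minn (f.1.2 + f.2 + 2) (n - f.1.2 + (n - f.2)))%:R / (k%:R * n%:R).
Proof.
case: f => [[l a] b]; set m := minn _ _; rewrite /=.
have k0 : (0 < k)%N by apply: leq_ltn_trans (ltn_ord l).
have n0 : (0 < n)%N by apply: leq_ltn_trans (ltn_ord a).
have kn0 : 0 < k%:R * n%:R ^+ 2 :> R by rewrite mulr_gt0 ?exprn_gt0 ?ltr0n.
have -> : forall x : R, x / k%:R = (x * n%:R ^+ 2) / (k%:R * n%:R ^+ 2).
  by move=> x; field; rewrite !pnatr_eq0 -!lt0n n0.
have -> : m%:R / (k%:R * n%:R) = (n%:R * m%:R) / (k%:R * n%:R ^+ 2) :> R.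
  by field; rewrite !pnatr_eq0 -!lt0n n0.
rewrite -mulrDl /freq.
have -> : #|{: box k n}|%:R = k%:R * n%:R ^+ 2 :> R.
  by rewrite !card_prod !card_ord -mulnA natrM natrM.
rewrite ler_pM2r ?invr_gt0// -!natrX -!natrM -!natrD ler_nat.
exact: (card_outer_inv s (l, a, b)).
Qed.

(** * Mass of the boxes and passage from samples to words *)

Lemma in_box_itv (R : realType) (k n : nat) (s : 'S_k) (f : box k n) :
  (0 < k * n)%N ->
  in_box (R := R) s f =
  `](box_col f)%:R / (k * n)%:R, (box_col f).+1%:R / (k * n)%:R] `*`
  `](box_row s f)%:R / (k * n)%:R, (box_row s f).+1%:R / (k * n)%:R].
Proof.
move=> kn0; have N0 : 0 < (k * n)%:R :> R by rewrite ltr0n.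
apply/seteqP; split => -[x y]; rewrite /in_box/= !ceil_eqE !in_itv/=;
  rewrite !(mulrC (k * n)%:R) !(ltr_pdivrMr _ _ N0) !(ler_pdivlMr _ _ N0).
  by move=> /andP[].
by move=> [-> ->].
Qed.

Lemma measurable_in_box (R : realType) (k n : nat) (s : 'S_k) (f : box k n) :
  (0 < k * n)%N -> measurable (in_box (R := R) s f).
Proof. by move=> kn0; rewrite in_box_itv//; apply: measurableX. Qed.

Lemma in_box_inj (R : realType) (k n : nat) (s : 'S_k) (f g : box k n)
    (z : R * R) : in_box s f z -> in_box s g z -> f = g.
Proof.
move=> fz gz.
have c x y := in_box_col (f := x) (g := y) (z := z) (z' := z) (s := s).
have r x y := in_box_row (f := x) (g := y) (z := z) (z' := z) (s := s).
have {c} : box_col f = box_col g.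
  case: (ltngtP (box_col f) (box_col g)) => // lt;
    [have := c _ _ _ fz gz lt|have := c _ _ _ gz fz lt]; by rewrite ltxx.
have {r} : box_row s f = box_row s g.
  case: (ltngtP (box_row s f) (box_row s g)) => // lt;
    [have := r _ _ _ fz gz lt|have := r _ _ _ gz fz lt]; by rewrite ltxx.
clear; move=> rE cE.
have := ltn_box_col f g; have := ltn_box_col g f.
have := ltn_box_row s f g; have := ltn_box_row s g f.
rewrite rE cE !ltnn.
case: f g {rE cE} => [[l a] b] [[l' a'] b'] /=.
case: (eqVneq l l') => [<-|ll'] b1 b2 a1 a2; last first.
  by move: ll'; rewrite -(inj_eq val_inj)/=; lia.
move: a1 a2 b1 b2; rewrite !ltnn/=.
by case: (ltngtP a a') => // /ord_inj-> _ _; case: (ltngtP b b') => // /ord_inj->.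
Qed.

(** The density equals k throughout the box, whose area is 1 / (k n)^2. *)
Lemma empirical_permuton_in_box (R : realType) (k n : nat) (s : 'S_k)
    (f : box k n) : (0 < k)%N -> (0 < n)%N ->
  empirical_permuton s (in_box s f) = (#|{: box k n}|%:R^-1 : R)%:E.
Proof.
move=> k0 n0; have kn0 : (0 < k * n)%N by rewrite muln_gt0 k0.
have N0 : 0 < (k * n)%:R :> R by rewrite ltr0n.
rewrite /empirical_permuton (eq_integral (cst (k%:R : R)%:E)); last first.
  move=> [x y]; rewrite inE => /andP[/=]; rewrite !ceil_eqE => xf yf.
  rewrite /empirical_density ifT//; apply/existsP; exists f.1.1.
  have n0' : 0 < n%:R :> R by rewrite ltr0n.
  (* The fine interval of a box lies in the coarse interval of its cell, so the ceilings at scale k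
     are determined. *)
  have colE (c : nat) (i : 'I_n) (u : R) :
      (c * n + i)%:R < (k * n)%:R * u <= (c * n + i).+1%:R ->
      c%:R * n%:R < k%:R * u * n%:R <= c.+1%:R * n%:R.
    rewrite natrM mulrAC => /andP[lo hi]; apply/andP; split.
      by apply: le_lt_trans lo; rewrite natrD natrM lerDl.
    apply: (le_trans hi); rewrite -natrM ler_nat mulSn.
    by rewrite addnC ltn_add2r.
  apply/andP; split; rewrite ceil_eqE -(ltr_pM2r n0') -(ler_pM2r n0').
    exact: colE xf.
  exact: colE yf.
rewrite integral_cst; last exact: measurable_in_box.
rewrite in_box_itv//; set I := `](box_col f)%:R / _, _]; set J := `]_, _].
transitivity ((k%:R)%:E * (lebesgue_measure ([set` I] : set R) *
    lebesgue_measure ([set` J] : set R)) : \bar R)%E.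
  by congr (_ * _)%E; apply: product_measure1E.
rewrite !lebesgue_measure_itv/= !lte_fin.
rewrite !ltr_pM2r ?invr_gt0// !ltr_nat !ltnSn -!EFinD -!mulrBl.
rewrite -!natrB// !subSnn -!EFinM; congr (_%:E).
rewrite !card_prod !card_ord !natrM.
by field; rewrite !pnatr_eq0 -!lt0n k0 n0.
Qed.

Lemma probability_bigcup_const (R : realType) (d : measure_display)
    (T : measurableType d) (P : probability T R) (I : finType) (W : {set I})
    (E : I -> set T) (c : R) : (forall i, measurable (E i)) ->
  (forall i j x, E i x -> E j x -> i = j) ->
  (forall i, P (E i) = c%:E) ->
  P (\bigcup_(i in [set` W]) E i) = (#|W|%:R * c)%:E.
Proof.
move=> mE injE PE.
have -> : \bigcup_(i in [set` W]) E i =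
    \big[setU/set0]_(i < #|W|) E (enum_val i).
  rewrite -(@bigcup_pred _ _ predT)/=; apply/seteqP; split => x [i /= iW xE].
    by exists (enum_rank_in iW i) => //; rewrite enum_rankK_in.
  by exists (enum_val i) => //; apply: enum_valP.
rewrite measure_bigsetU_ord//.
  rewrite (eq_bigr (fun=> c%:E)) => [|i _]; last exact: PE.
  by rewrite sumEFin sumr_const card_ord mulr_natl.
move=> i j _ _ [x [xi xj]]; apply: enum_val_inj; exact: injE xi xj.
Qed.

(* The boxes have mass [1 / #|box|] each, so they carry the whole measure and
   the box labels of the sample are uniform on [{ffun 'I_n -> box k n}]. *)
Lemma probability_le_freq (R : realType) (k n : nat) (s : 'S_k)
    (d : measure_display) (T : measurableType d) (P : probability T R)
    (Z : 'I_n -> {RV P >-> (R * R)%type}) (B : set T)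
    (W : {set {ffun 'I_n -> box k n}}) :
  (0 < k)%N -> (0 < n)%N -> iid_sample (empirical_permuton s) Z ->
  measurable B ->
  (forall (w : {ffun 'I_n -> box k n}) x, (forall i, in_box s (w i) (Z i x)) ->
    B x -> w \in W) ->
  (P B <= (freq R W)%:E)%E.
Proof.
move=> k0 n0 [indep dist] mB BW; have kn0 : (0 < k * n)%N by rewrite muln_gt0 k0.
pose E (w : {ffun 'I_n -> box k n}) :=
  \bigcap_(i in [set: 'I_n]) (Z i @^-1` in_box s (w i)).
have mbox i (f : box k n) : measurable (Z i @^-1` in_box s f).
  by rewrite -[X in measurable X]setTI; apply: measurable_funP => //;
    apply: measurable_in_box.
have mE w : measurable (E w).
  by apply: fin_bigcap_measurable => // i _; apply: mbox.
have injE w v x : E w x -> E v x -> w = v.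
  move=> wx vx; apply/ffunP => i; exact: in_box_inj (wx i I) (vx i I).
have PE w : P (E w) = (#|{: {ffun 'I_n -> box k n}}|%:R^-1)%:E.
  rewrite indep => [|i]; last exact: measurable_in_box.
  rewrite (eq_bigr (fun=> (#|{: box k n}|%:R^-1 : R)%:E)) => [|i _].
    by rewrite prodEFin prodr_const card_ord card_ffun card_ord natrX exprVn.
  rewrite -(empirical_permuton_in_box _ s (w i))// -(dist i)//.
  exact: measurable_in_box.
have PU := probability_bigcup_const _ mE injE PE.
pose U := \bigcup_(w in [set` [set: {ffun 'I_n -> box k n}]%SET]) E w.
have mU V : measurable (\bigcup_(w in [set` V : {set {ffun 'I_n -> box k n}}]) E w).
  by apply: fin_bigcup_measurable => //; apply: finite_finset.
have box0 : (0 < #|{: {ffun 'I_n -> box k n}}|)%N.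
  by rewrite card_ffun expn_gt0 !card_prod !card_ord -mulnA !muln_gt0 k0 n0.
have PU1 : P U = 1%E.
  by rewrite PU cardsT divff// pnatr_eq0 -lt0n.
rewrite -(PU W) /freq.
apply: (@le_trans _ _ (P (\bigcup_(w in [set` W]) E w `|` ~` U))).
  apply: le_measure; rewrite ?inE//.
    by apply: measurableU => //; apply: measurableC; apply: mU.
  move=> x Bx; have [[w _ wx]|Ux] := pselect (U x); last by right.
  by left; exists w => //=; apply: BW Bx => i; apply: wx.
apply: (le_trans (measureU2 _ _ _)) => //.
  by apply: measurableC; apply: mU.
have PUC : P (~` U) = 0%E by rewrite probability_setC ?PU1 ?subee//; apply: mU.
by rewrite [X in (_ + X)%E]PUC adde0.
Qed.

(** * Convergence in law *)

Lemma integrable_bounded (R : realType) (Q : probability R R) (f : R -> R)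
    (C : R) : measurable_fun setT f -> (forall x, `|f x| <= C) ->
  Q.-integrable setT (EFin \o f).
Proof.
move=> mf fC; apply: measurable_bounded_integrable => //.
  by apply: le_lt_trans (probability_le1 _ _) _ => //; exact: ltry.
by exists C; split; rewrite ?num_real// => M CM x _; apply: le_trans (ltW CM).
Qed.

Lemma Rintegral_indic (R : realType) (Q : probability R R) (A : set R) :
  measurable A -> \int[Q]_x \1_A x = fine (Q A).
Proof. by move=> mA; rewrite /Rintegral integral_indic// setIT. Qed.

(** The difference is dominated by e plus 2 C times the indicator of the complement of [K]. This
    serves both the approximation by step functions and the limit to a point mass. *)
Lemma dist_Rintegral_le (R : realType) (Q : probability R R) (f h : R -> R)
    (C e : R) (K : set R) :
  measurable_fun setT f -> measurable_fun setT h -> measurable K ->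
  (forall x, `|f x| <= C) -> (forall x, `|h x| <= C) -> 0 <= e ->
  (forall x, K x -> `|f x - h x| <= e) ->
  `|\int[Q]_x f x - \int[Q]_x h x| <= e + 2 * C * fine (Q (~` K)).
Proof.
move=> mf mh mK fC hC e0 fh.
have If := integrable_bounded Q mf fC; have Ih := integrable_bounded Q mh hC.
have mfh : measurable_fun setT (fun x => f x - h x) by apply: measurable_funB.
have C0 : 0 <= C by apply: le_trans (fC 0).
have fhC x : `|f x - h x| <= 2 * C.
  by apply: (le_trans (ler_normB _ _)); have := fC x; have := hC x; lra.
have mKC : measurable (~` K) by apply: measurableC.
rewrite -RintegralB//.
apply: (le_trans (le_normr_Rintegral _ _)) => //.
  exact: integrable_bounded fhC.
have m1 : measurable_fun setT (fun x => e + 2 * C * \1_(~` K) x).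
  by apply: measurable_funD => //; apply: measurable_funM => //.
have b1 x : `|e + 2 * C * \1_(~` K) x| <= e + 2 * C.
  rewrite ger0_norm; rewrite indicE; case: (_ \in _); rewrite /=; lra.
have b2 x : `|(`|f x - h x|)| <= 2 * C by rewrite normr_id.
apply: (@le_trans _ _ (\int[Q]_x (e + 2 * C * \1_(~` K) x))).
  apply: le_Rintegral => //.
  - by apply: integrable_bounded b2; apply: measurableT_comp.
  - exact: integrable_bounded b1.
  move=> x _; rewrite indicE; case: (asboolP (K x)) => Kx.
    rewrite memNset; last by move=> /(_ Kx).
    by rewrite mulr0 addr0; apply: fh.
  by rewrite mem_set// mulr1; have := fhC x; lra.
have I1 : Q.-integrable setT (EFin \o (fun=> e)).
  by apply: (@integrable_bounded _ _ _ e) => // x; rewrite ger0_norm.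
have I2 : Q.-integrable setT (EFin \o (fun x => 2 * C * \1_(~` K) x)).
  apply: (@integrable_bounded _ _ _ (2 * C)).
    by apply: measurable_funM => //.
  by move=> x; rewrite ger0_norm; rewrite indicE; case: (_ \in _); rewrite /=; lra.
have I3 : Q.-integrable setT (EFin \o \1_(~` K)).
  apply: (@integrable_bounded _ _ _ 1) => //.
  by move=> x; rewrite ger0_norm; rewrite indicE; case: (_ \in _); rewrite /=; lra.
have Q1 : fine (Q [set: R]) = 1 by rewrite probability_setT.
rewrite RintegralD// Rintegral_cst// [X in _ * X + _]Q1 mulr1.
by rewrite RintegralZl// Rintegral_indic.
Qed.

Definition tail (R : realType) (Q : probability R R) (t : R) : R :=
  fine (Q `]t, +oo[%classic).

(** Each interval ]t_i, t_(i+1)] is written as a difference of two rays, so that integrals only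
    involve tails, which is all that is known of the laws. *)
Definition step (R : realType) (f t : nat -> R) (m : nat) (x : R) : R :=
  \sum_(i < m) f i * (\1_(`]t i, +oo[%classic) x - \1_(`]t i.+1, +oo[%classic) x).

Lemma measurable_step (R : realType) (f t : nat -> R) (m : nat) :
  measurable_fun setT (step f t m).
Proof.
apply: measurable_sum => i; apply: measurable_funM => //.
by apply: measurable_funB.
Qed.

Lemma step_in (R : realType) (f t : nat -> R) (m : nat) (x : R) :
  {homo t : i j / (i <= j)%N >-> i <= j} -> t 0%N < x -> x <= t m ->
  exists2 i, t i < x <= t i.+1 & step f t m x = f i.
Proof.
move=> ht t0x; rewrite /step; elim: m => [|m IH xm]; first by rewrite leNgt t0x.
have [xt|tx] := leP x (t m).
  have [i it fi] := IH xt; exists i => //; rewrite big_ord_recr/= fi.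
  rewrite !indicE !memNset/= ?subr0 ?mulr0 ?addr0// in_itv/= andbT; apply/negP;
    by rewrite -leNgt.
exists m; rewrite ?tx// big_ord_recr/= big1 ?add0r.
  rewrite !indicE mem_set/= ?in_itv/= ?tx// memNset/= ?subr0 ?mulr1// in_itv/= andbT.
  by apply/negP; rewrite -leNgt.
move=> i _; rewrite !indicE !mem_set/= ?subrr ?mulr0// in_itv/= andbT.
  by apply: le_lt_trans tx; apply: ht; apply: ltn_ord.
by apply: le_lt_trans tx; apply: ht; apply: ltnW.
Qed.

Lemma step_out (R : realType) (f t : nat -> R) (m : nat) (x : R) :
  {homo t : i j / (i <= j)%N >-> i <= j} -> x <= t 0%N \/ t m < x ->
  step f t m x = 0.
Proof.
move=> ht xt; apply: big1 => i _; rewrite !indicE.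
case: xt => xt.
  rewrite !memNset/= ?subrr ?mulr0// in_itv/= andbT; apply/negP; rewrite -leNgt;
    by apply: (le_trans xt); apply: ht.
rewrite !mem_set/= ?subrr ?mulr0// in_itv/= andbT; apply: le_lt_trans xt;
  by apply: ht => //; apply: ltnW.
Qed.

Lemma Rintegral_step (R : realType) (Q : probability R R) (f t : nat -> R)
    (m : nat) :
  \int[Q]_x step f t m x = \sum_(i < m) f i * (tail Q (t i) - tail Q (t i.+1)).
Proof.
have I1 (u : R) : Q.-integrable setT (EFin \o \1_(`]u, +oo[%classic)).
  apply: (@integrable_bounded _ _ _ 1) => //.
  by move=> x; rewrite ger0_norm indicE; case: (_ \in _); rewrite /=; lra.
have I2 (u v : R) : Q.-integrable setT (EFin \o
    (fun x => \1_(`]u, +oo[%classic) x - \1_(`]v, +oo[%classic) x)).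
  exact: (integrableB measurableT (I1 u) (I1 v)).
have I3 (c u v : R) : Q.-integrable setT (EFin \o
    (fun x => c * (\1_(`]u, +oo[%classic) x - \1_(`]v, +oo[%classic) x))).
  exact: (integrableZl measurableT c (I2 u v)).
have I4 p : Q.-integrable setT (EFin \o step f t p).
  elim: p => [|p IH].
    apply: (@integrable_bounded _ _ _ 0) => [|x]; first exact: measurable_step.
    by rewrite /step big_ord0 normr0.
  have -> : EFin \o step f t p.+1 = fun x => ((step f t p x)%:E + (f p *
      (\1_(`]t p, +oo[%classic) x - \1_(`]t p.+1, +oo[%classic) x))%:E)%E.
    by apply/funext => x; rewrite /step /= big_ord_recr/= EFinD.
  by apply: integrableD => //; apply: I3.
elim: m => [|m IH].
  rewrite big_ord0; transitivity (\int[Q]_x (cst 0 x)).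
    by apply: eq_Rintegral => x _; rewrite /step big_ord0.
  by rewrite Rintegral_cst// mul0r.
rewrite big_ord_recr/= -IH.
transitivity (\int[Q]_x (step f t m x + f m *
    (\1_(`]t m, +oo[%classic) x - \1_(`]t m.+1, +oo[%classic) x))).
  by apply: eq_Rintegral => x _; rewrite /step big_ord_recr.
by rewrite RintegralD// RintegralZl// RintegralB// !Rintegral_indic.
Qed.

(** Heine-Cantor by the covering form of compactness: near each point of the segment a single radius
    works, with r / 2 spent on moving the point and r / 2 on reaching [y]. *)
Lemma uniformly_continuous_itv (R : realType) (f : R -> R) (M e : R) :
  continuous f -> 0 < e ->
  exists2 d : R, 0 < d & forall x y : R, x \in `[0, M] -> `|x - y| <= d ->
    `|f x - f y| <= e.
Proof.
move=> cf e0.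
have /compact_near_coveringP cov := @segment_compact R 0 M.
have H : \forall d \near 0^'+, `[0, M]%classic `<=`
    (fun x => forall y, `|x - y| <= d -> `|f x - f y| <= e).
  apply: cov => x _.
  have /cvgrPdist_lt /(_ (e / 2)) := cf x; rewrite divr_gt0// => /(_ isT).
  move=> /nbhs_ballP[r /= r0 fr].
  exists (ball x (r / 2), [set d | d < r / 2]) => /=; first split.
  - by apply: nbhsx_ballx; rewrite divr_gt0.
  - by apply: nbhs_right_lt; rewrite divr_gt0.
  move=> [x' d] [/= xx' dr] y x'y.
  have fx' : `|f x - f x'| < e / 2.
    by apply: fr; rewrite /ball/= in xx' *; lra.
  have fy : `|f x - f y| < e / 2.
    apply: fr; rewrite /ball/= in xx' *.
    have -> : x - y = (x - x') + (x' - y) by ring.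
    by apply: (le_lt_trans (ler_normD _ _)); lra.
  have -> : f x' - f y = (f x - f y) - (f x - f x') by ring.
  by apply: (le_trans (ler_normB _ _)); lra.
near (0 : R)^'+ => d; exists d; first by near: d; exact: nbhs_right_gt.
have Hd : `[0, M]%classic `<=`
    (fun x => forall y, `|x - y| <= d -> `|f x - f y| <= e) by near: d.
by move=> x y xM; apply: Hd.
Unshelve. all: by end_near.
Qed.

(* Off [0, M], where the mass is small, the bound on f suffices; on [0, M], f is
   close to a step function, whose integral is a combination of tails. *)
Lemma cvg_Rintegral_of_tail (R : realType) (Q : nat -> probability R R)
    (nu : probability R R) (f : R -> R) : continuous f -> bounded_fun f ->
  (forall t, 0 <= t -> tail (Q n) t @[n --> \oo] --> tail nu t) ->
  nu `]0, +oo[%classic = 1%E ->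
  \int[Q n]_x f x @[n --> \oo] --> \int[nu]_x f x.
Proof.
move=> cf [C0 [_ fC0]] cvt nu0.
have [C C_gt0 fC] : exists2 C : R, 0 < C & forall x, `|f x| <= C.
  exists (`|C0| + 1); first by rewrite ltr_wpDl.
  by move=> x; apply: fC0 => //; rewrite ltr_pwDr// ler_norm.
have mf : measurable_fun setT f by apply: continuous_measurable_fun.
suff H (e : R) : 0 < e -> \forall n \near \oo,
    `|\int[nu]_x f x - \int[Q n]_x f x| <= e.
  by apply/cvgrPdist_le => e; apply: H.
(* The three errors in the final estimate are at most e' + 2 C e', e' and e' + 4 C e', which fits in
   6 (1 + C) e'. *)
move=> e0; have [e' e'0 eE] : exists2 e' : R, 0 < e' & e = e' * (6 * (1 + C)).
  have C1 : 0 < 6 * (1 + C) by rewrite mulr_gt0// addr_gt0.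
  by exists (e / (6 * (1 + C))); [rewrite divr_gt0|rewrite divfK// gt_eqF].
have [M M0 Me] : exists2 M : R, 0 < M & tail nu M <= e'.
  (* The identity is seen as a random variable so that the decay of its complementary distribution
     function applies to [nu] itself. *)
  pose X : {RV nu >-> R} := HB.pack (@idfun R)
    (isMeasurableFun.Build _ _ _ _ (@idfun R) (@measurable_id _ R setT)).
  have /fine_cvgP[_ /cvgrPdist_le/(_ e' e'0) H] := cvg_ccdfy0 X.
  near (+oo%R : set_system R) => M; exists M; first by near: M; exact: nbhs_pinfty_gt.
  apply: le_trans (ler_norm _) _; rewrite -normrN -[- _]add0r.
  by near: M.
have [dlt dlt0 fd] := uniformly_continuous_itv M cf e'0.
(* Enough equal pieces of [0, M] for the mesh M / m to be at most [dlt]. *)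
pose m := (Num.trunc (M / dlt)).+1.
pose t i : R := M / m%:R * i%:R.
have m0 : 0 < m%:R :> R by rewrite ltr0n.
have tm : t m = M by rewrite /t divfK// gt_eqF.
have t0 : t 0%N = 0 by rewrite /t mulr0.
have ht : {homo t : i j / (i <= j)%N >-> i <= j}.
  by move=> i j ij; rewrite ler_wpM2l ?ler_nat// divr_ge0// ltW.
have td i : t i.+1 - t i <= dlt.
  rewrite /t -mulrBr -natrB// subSnn mulr1 ler_pdivrMr// mulrC -ler_pdivrMr//.
  exact/ltW/truncnS_gt.
pose h := step (f \o t) t m.
have mh : measurable_fun setT h by apply: measurable_step.
pose K := `]0, M]%classic : set R.
have mK : measurable K by exact: measurable_itv.
have fh x : K x -> `|f x - h x| <= e'.
  rewrite /K/= in_itv/= => /andP[x0 xM].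
  have [||i /andP[tix xti] E] := @step_in _ (f \o t) t m x ht.
  - by rewrite t0.
  - by rewrite tm.
  rewrite (E : h x = _) /=; apply: fd; first by rewrite in_itv/= (ltW x0).
  by rewrite ger0_norm ?subr_ge0 ?(ltW tix)//; apply: le_trans (td i); rewrite lerD2r.
have hC x : `|h x| <= C.
  have [x0|x0] := leP x 0; first by rewrite /h step_out ?normr0 ?(ltW C_gt0)// t0; left.
  have [xM|xM] := leP x M; last first.
    by rewrite /h step_out ?normr0 ?(ltW C_gt0)// tm; right.
  have [||i _ E] := @step_in _ (f \o t) t m x ht; rewrite ?t0 ?tm//.
  by rewrite (E : h x = _) fC.
(* Off ]0, M] the mass is again a combination of tails. For [Q n] it includes mass on the
   nonpositive half-line, which disappears in the limit because [nu] has tail 1 at 0. *)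
have KC (q : probability R R) : fine (q (~` K)) = 1 - tail q 0 + tail q M.
  have -> : tail q 0 = fine (q K) + tail q M.
    rewrite /tail -fineD ?fin_num_measure//; congr fine.
    rewrite -measureU//; last first.
      by rewrite -subset0 /K => x /= []; rewrite !in_itv/= andbT => /andP[_ xM];
        rewrite ltNge xM.
    by congr (q _); apply: itv_bndbnd_setU; rewrite bnd_simp ?(ltW M0).
  rewrite probability_setC// fineB ?fin_num_measure//=.
  by set a := fine _; set b := tail q M; lra.
have fhQ (q : probability R R) :
    `|\int[q]_x f x - \int[q]_x h x| <= e' + 2 * C * (1 - tail q 0 + tail q M).
  by rewrite -KC; apply: dist_Rintegral_le => //; exact: ltW.
have tnu0 : tail nu 0 = 1 by rewrite /tail nu0.
have cvh : \int[Q n]_x h x @[n --> \oo] --> \int[nu]_x h x.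
  rewrite /h Rintegral_step; under eq_fun do rewrite Rintegral_step.
  apply: cvg_big => [|i _]; first exact: add_continuous.
  by apply: cvgMl_tmp; apply: cvgB; apply: cvt; rewrite -t0; apply: ht.
have cvK : 1 - tail (Q n) 0 + tail (Q n) M @[n --> \oo] --> 1 - tail nu 0 + tail nu M.
  by apply: cvgD; [apply: cvgB; [exact: cvg_cst|exact: cvt]|exact/cvt/ltW].
have cvh' := cvh; move/cvgrPdist_le : cvh' => /(_ e' e'0) cvh'.
have cvK' := cvK; move/cvgrPdist_le : cvK' => /(_ e' e'0) cvK'.
near=> n.
have H1 : `|\int[nu]_x h x - \int[Q n]_x h x| <= e' by near: n.
have H2 : `|1 - tail nu 0 + tail nu M - (1 - tail (Q n) 0 + tail (Q n) M)| <= e'.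
  by near: n.
have H3 := fhQ (Q n); have H4 := fhQ nu.
rewrite tnu0 in H2 H4.
move: H1 H3 H4; set a := \int[nu]_x h x; set b := \int[Q n]_x h x;
  set u := \int[nu]_x f x; set v := \int[Q n]_x f x.
set p := 1 - tail (Q n) 0 + tail (Q n) M in H2 *; move=> H1 H3 H4.
have p2 : p <= 2 * e'.
  have := ler_norm (p - (1 - 1 + tail nu M)); rewrite distrC; lra.
have H3' : `|v - b| <= e' + 4 * C * e'.
  by apply: (le_trans H3); rewrite lerD2l; nra.
have H4' : `|u - a| <= e' + 2 * C * e'.
  by apply: (le_trans H4); rewrite lerD2l ler_pM2l ?mulr_gt0//; lra.
have -> : u - v = (u - a) + (a - b) - (v - b) by ring.
apply: (le_trans (ler_normB _ _)).
have : 0 < C * e' by rewrite mulr_gt0.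
have := ler_normD (u - a) (a - b); rewrite eE; lra.
Unshelve. all: by end_near.
Qed.

Lemma cvg_in_lawP (R : realType) (d : nat -> measure_display)
    (T : forall n, measurableType (d n)) (P : forall n, probability (T n) R)
    (X : forall n, {RV (P n) >-> R}) (nu : probability R R) :
  (forall f : R -> R, continuous f -> bounded_fun f ->
     \int[distribution (P n) (X n)]_x f x @[n --> \oo] --> \int[nu]_x f x) ->
  cvg_in_law X nu.
Proof.
move=> H f cf bf.
have mf : measurable_fun setT f by apply: continuous_measurable_fun.
have [C fC] : exists C : R, forall x, `|f x| <= C.
  by case: bf => C [_ fC]; exists (`|C| + 1) => x; apply: fC => //;
    rewrite ltr_pwDr// ler_norm.
have EE n : 'E_(P n)[f \o X n]%E = (\int[distribution (P n) (X n)]_x f x)%:E.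
  rewrite fineK.
    rewrite unlock integral_distribution//; first exact/measurable_EFinP.
    apply: measurable_bounded_integrable => //.
    - by apply: le_lt_trans (probability_le1 _ _) _ => //; exact: ltry.
    - exact: measurableT_comp.
    by exists C; split; rewrite ?num_real// => M CM x _; apply: le_trans (ltW CM).
  by apply: integrable_fin_num => //; apply: integrable_bounded fC.
rewrite (funext EE) -[X in _ --> X]fineK.
  by apply/cvg_EFin; [near=> n|exact: H].
by apply: integrable_fin_num => //; apply: integrable_bounded fC.
Unshelve. all: by end_near.
Qed.

(** On a small ball around [c] the test function is close to the constant f c, and the mass off that
    ball is exactly the probability that tends to 0. *)
Lemma cvg_in_probability_law (R : realType) (d : nat -> measure_display)
    (T : forall n, measurableType (d n)) (P : forall n, probability (T n) R)
    (X : forall n, {RV (P n) >-> R}) (c : R) :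
  cvg_in_probability X c -> cvg_in_law X \d_c.
Proof.
move=> Xc; apply: cvg_in_lawP => f cf bf.
have mf : measurable_fun setT f by apply: continuous_measurable_fun.
have [C C0 fC] : exists2 C : R, 0 < C & forall x, `|f x| <= C.
  case: bf => C [_ fC]; exists (`|C| + 1); first by rewrite ltr_wpDl.
  by move=> x; apply: fC => //; rewrite ltr_pwDr// ler_norm.
have -> : \int[\d_c]_x f x = f c.
  have mEf : measurable_fun setT (EFin \o f) by exact/measurable_EFinP.
  by rewrite /Rintegral (integral_dirac c measurableT mEf) diracT mul1e.
suff H (e : R) : 0 < e -> \forall n \near \oo,
    `|f c - \int[distribution (P n) (X n)]_x f x| <= e.
  by apply/cvgrPdist_le => e; apply: H.
move=> e0; have e20 : 0 < e / 2 by rewrite divr_gt0.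
have /cvgrPdist_lt/(_ _ e20)/nbhs_ballP[r /= r0 fr] := cf c.
have r20 : 0 < r / 2 by rewrite divr_gt0.
have /fine_cvgP[_ /cvgrPdist_le] := Xc _ r20.
(* Multiplied by the factor 2 C of [dist_Rintegral_le], this is the missing e / 2. *)
have eC0 : 0 < e / (4 * C) by rewrite divr_gt0// mulr_gt0.
move=> /(_ _ eC0) Pn; near=> n.
pose K : set R := [set x | `|x - c| <= r / 2].
have mK : measurable K.
  have -> : K = `[c - r / 2, c + r / 2]%classic.
    by apply/seteqP; split => x; rewrite /K/= in_itv/= ler_distl.
  exact: measurable_itv.
have := @dist_Rintegral_le _ (distribution (P n) (X n)) f (fun=> f c) C (e / 2) K mf.
have Q1 : fine (distribution (P n) (X n) [set: R]) = 1 by rewrite probability_setT.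
rewrite Rintegral_cst// [X in `|_ - _ * X|]Q1.
rewrite mulr1 distrC => /(_ _ mK fC (fun=> fC c) (ltW e20)).
have DE : fine (distribution (P n) (X n) (~` K)) =
    fine (P n [set w | r / 2 < `|X n w - c|]).
  congr (fine (P n _)); apply/seteqP; split => w; rewrite /K/= ?ltNge//; by move/negP.
rewrite [X in _ + _ * X]DE.
have : `|0 - fine (P n [set w | r / 2 < `|X n w - c|])| <= e / (4 * C) by near: n.
rewrite sub0r normrN ger0_norm ?fine_ge0//.
rewrite ler_pdivlMr ?mulr_gt0// => Pe H; apply: le_trans (H _ _) _ => //.
  move=> x; rewrite /K/= => xK; rewrite distrC ltW//; apply: fr.
  by rewrite /ball/= distrC; lra.
lra.
Unshelve. all: by end_near.
Qed.

(* Inverse transform: [sqrt (- ln u / b) > t] iff [u < exp (- b t^2)]. *)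
Lemma exists_rayleigh (R : realType) (b : R) : 0 < b ->
  exists nu : probability R R, is_rayleigh 2 b nu.
Proof.
move=> b0; pose U : probability _ R := uniform_prob (@ltr01 R).
pose g (u : R) : R := Num.sqrt (- ln u / b).
have mg : measurable_fun setT g.
  apply: measurableT_comp.
    by apply: continuous_measurable_fun; apply: sqrt_continuous.
  by apply: measurable_funM => //; apply: measurableT_comp.
pose X : {RV U >-> R} := HB.pack g
  (isMeasurableFun.Build _ _ (g_sigma_algebraType R.-ocitv.-measurable) R g mg).
exists (distribution U X); split.
  rewrite /distribution/= /pushforward [X in U X](_ : _ = setT) ?probability_setT//.
  by apply/seteqP; split => // u _ /=; rewrite in_itv/= andbT sqrtr_ge0.
move=> t t0; rewrite /distribution/= /pushforward.
set q := expR _.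
have q01 : 0 < q <= 1.
  by rewrite expR_gt0 -expR0 ler_expR oppr_le0 mulr_ge0 ?(ltW b0)// powR_ge0.
rewrite powR_mulrn// in q q01 *.
have -> : X @^-1` `]t, +oo[ = `]0, q[%classic.
  apply/seteqP; split => u /=; rewrite !in_itv/= andbT.
    move=> tg; have gu0 : 0 < - ln u / b.
      by rewrite -sqrtr_gt0; apply: le_lt_trans tg.
    have : t ^+ 2 < - ln u / b.
      by rewrite -(sqr_sqrtr (ltW gu0)) ltr_pXn2r ?nnegrE ?sqrtr_ge0.
    rewrite ltr_pdivlMr// mulrC ltrNr => lnu.
    (* [ln] is 0 at nonpositive arguments, so [g] vanishes there and cannot exceed [t]. *)
    have u0 : 0 < u.
      rewrite ltNge; apply/negP => u0; move: gu0.
      by rewrite ln0// oppr0 mul0r ltxx.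
    by rewrite u0/= -(lnK u0) ltr_expR.
  move=> /andP[u0 uq]; rewrite /X/= /g -[t in t < _]ger0_norm// -sqrtr_sqr.
  have lnu : t ^+ 2 < - ln u / b.
    by rewrite ltr_pdivlMr// mulrC ltrNr -ltr_expR lnK.
  by rewrite ltr_sqrt// (le_lt_trans _ lnu)// sqr_ge0.
rewrite /U/= /uniform_prob (eq_integral (cst 1%E)).
  have L : lebesgue_measure (`]0, q[%classic : set R) = q%:E.
    by rewrite lebesgue_measure_itv/= lte_fin; case/andP: q01 => -> _; rewrite sube0.
  by rewrite integral_cst// mul1e; exact: L.
move=> u; rewrite inE/= in_itv/= /uniform_pdf => /andP[u0 uq].
by rewrite (ltW u0) (le_trans (ltW uq)) ?subr0 ?invr1//; case/andP: q01.
Qed.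

(** * Tail estimates for the minimal inversion *)

(* The boxes of two opposite corner triangles in the cells of [D], i.e., those
   with few inversions inside their cell. *)
Definition corner_boxes (k n : nat) (D : {set 'I_k}) (p : nat) :
    {set box k n} :=
  [set f : box k n | (f.1.1 \in D) && ((f.1.2 + f.2 < p)%N ||
                             (rev_ord f.1.2 + rev_ord f.2 < p)%N)]%SET.

Lemma sum_subn_ord (p : nat) : (2 * \sum_(i < p) (p - i) = p * p.+1)%N.
Proof.
elim: p => [|p IH]; first by rewrite big_ord0.
rewrite big_ord_recl subn0 mulnDr.
rewrite (eq_bigr (fun i : 'I_p => (p - i)%N)) => [|i _]; last by rewrite lift0 subSS.
by rewrite IH; ring.
Qed.

Lemma card_triangle (n p : nat) : (p <= n)%N ->
  (2 * #|[set g : 'I_n * 'I_n | (g.1 + g.2 < p)%N]%SET| = p * p.+1)%N.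
Proof.
move=> pn; rewrite -sum_subn_ord; congr (2 * _)%N.
rewrite -sum1dep_card.
rewrite -(pair_big_dep xpredT (fun i j : 'I_n => (i + j < p)%N) (fun _ _ => 1%N))/=.
rewrite (eq_bigr (fun i : 'I_n => (p - i)%N)) => [|i _].
  rewrite [in RHS](big_ord_widen n (fun i => (p - i)%N))// [in RHS]big_mkcond/=.
  by apply: eq_bigr => i _; case: ltnP => // /eqP.
rewrite sum1dep_card -[RHS](@card_ord_ltn n); last by lia.
by apply: eq_card => j; rewrite !inE; lia.
Qed.

(** Reversing both coordinates exchanges the two triangles of a cell, and p < n keeps them disjoint;
    each has p (p + 1) / 2 boxes. *)
Lemma card_corner_boxes (k n : nat) (D : {set 'I_k}) (p : nat) : (p < n)%N ->
  #|corner_boxes n D p| = (#|D| * (p * p.+1))%N.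
Proof.
move=> pn; pose S := [set g : 'I_n * 'I_n | (g.1 + g.2 < p)%N]%SET.
pose S' := [set g : 'I_n * 'I_n | (rev_ord g.1 + rev_ord g.2 < p)%N]%SET.
have S'E : S' = [set (rev_ord g.1, rev_ord g.2) | g in S]%SET.
  apply/setP => -[a b]; rewrite inE; apply/idP/imsetP => [ab|[[c e]]].
    exists (rev_ord a, rev_ord b); rewrite ?inE//=.
    by rewrite !rev_ordK.
  by rewrite inE/= => ce [-> ->]; have := ltn_ord c; have := ltn_ord e;
    move: ce; rewrite /=; lia.
have cS' : #|S'| = #|S|.
  rewrite S'E card_imset// => -[a b] [a' b'] [].
  move=> /= ha hb; have := ltn_ord a; have := ltn_ord a'; have := ltn_ord b.
  have := ltn_ord b' => *; congr pair; apply: ord_inj; lia.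
have cSS' : #|(S :|: S')%SET| = (p * p.+1)%N.
  rewrite cardsU cS' -(card_triangle (ltnW pn)) -/S.
  have -> : (S :&: S' = finset.set0)%SET.
    by apply/setP => -[a b]; rewrite !inE/=; lia.
  by rewrite cards0; lia.
rewrite -cSS' -cardsX.
have inj : injective (fun x : 'I_k * ('I_n * 'I_n) => (x.1, x.2.1, x.2.2) : box k n).
  by move=> [l [a b]] [l' [a' b']] [-> -> ->].
rewrite -(card_imset _ inj); apply: eq_card => -[[l a] b].
rewrite inE/=; apply/idP/imsetP => [lab|[[l' [a' b']] + [-> -> ->]]]; last first.
  by rewrite !inE.
by exists (l, (a, b)); rewrite // !inE.
Qed.

Lemma freq_corner_boxes (R : realType) (k n : nat) (D : {set 'I_k}) (p : nat) :
  (p < n)%N ->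
  freq R (corner_boxes n D p) =
  #|D|%:R * (p%:R * (p%:R + 1)) / (k%:R * n%:R ^+ 2).
Proof.
move=> pn; rewrite /freq card_corner_boxes// !natrM natr1; congr (_ / _).
by rewrite !card_prod !card_ord -mulnA natrM natrM.
Qed.

(** The predecessor of the truncation absorbs the excess of the outer count: a + b < trunc x - 1
    gives a + b + 2 <= x, and likewise at the opposite corner. The value [v] is 0 for splittings and
    the minimum in the linear regime. *)
Lemma outer_corner_le (R : realType) (k n : nat) (s : 'S_k) (D : {set 'I_k})
    (v : nat) (x : R) (f : box k n) :
  {in D, forall l, #|inversions (perm_points s) l| = v} ->
  f \in corner_boxes n D (Num.trunc x).-1 ->
  freq R (outer_inv s f) * n.-1%:R <= (v%:R * n%:R + x) / k%:R.
Proof.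
case: f => [[l a] b] Dv; rewrite inE/= => /andP[lD ab].
have k0 : (0 < k)%N by apply: leq_ltn_trans (ltn_ord l).
have n0 : (0 < n)%N by apply: leq_ltn_trans (ltn_ord a).
have k0' : 0 < k%:R :> R by rewrite ltr0n.
have n0' : 0 < n%:R :> R by rewrite ltr0n.
(* [Num.trunc] is 0 on negative numbers, and then there would be no corner box at all. *)
have x0 : 0 <= x.
  by apply: le_trans (ler01) _; rewrite -truncn_gt0; move: ab; lia.
have := freq_outer_inv R s (l, a, b); rewrite /= Dv//.
set m := minn _ _ => H.
have mx : m%:R <= x.
  apply: (@le_trans _ _ (Num.trunc x)%:R); last by rewrite truncn_le.
  by rewrite ler_nat /m; lia.
apply: (@le_trans _ _ (freq R (outer_inv s (l, a, b)) * n%:R)).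
  by rewrite ler_wpM2l ?freq_ge0// ler_nat leq_pred.
apply: (@le_trans _ _ ((v%:R / k%:R + m%:R / (k%:R * n%:R)) * n%:R)).
  by rewrite ler_wpM2r// ltW.
have -> : (v%:R / k%:R + m%:R / (k%:R * n%:R)) * n%:R =
    (v%:R * n%:R + m%:R) / k%:R :> R by field; rewrite !gt_eqF.
by rewrite ler_pM2r ?invr_gt0// lerD2l.
Qed.

Lemma inner_inv_ge (R : realType) (k n : nat) (s : 'S_k) (f : box k n) :
  #|inversions (perm_points s) f.1.1|%:R / k%:R <= freq R (inner_inv s f).
Proof.
apply: le_trans (freq_inner_inv R s f); rewrite lerDl.
have nE (i : 'I_n) : 0 <= n%:R - 1 - i%:R :> R.
  by rewrite subr_ge0 lerBrDr natr1 ler_nat.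
by rewrite divr_ge0 ?addr_ge0 ?mulr_ge0 ?exprn_ge0.
Qed.

(** Here the side is rounded up, opposite to [outer_corner_le]: leaving both triangles of side trunc
    y + 1 puts the box at grid distance at least y from either corner. *)
Lemma inner_off_corner_ge (R : realType) (k n : nat) (s : 'S_k) (y : R)
    (f : box k n) : 0 <= y -> y <= n%:R - 1 -> f.1.1 \in splittings s ->
  f \notin corner_boxes n (splittings s) (Num.trunc y).+1 ->
  (y * (n%:R - 1) - y ^+ 2 / 2) / (k%:R * n%:R ^+ 2) <= freq R (inner_inv s f).
Proof.
case: f => [[l a] b] y0 yn lD /=; rewrite inE lD/= negb_or -!leqNgt => /andP[h1 h2].
have yt : y < (Num.trunc y).+1%:R by exact: truncnS_gt.
have ab : y <= a%:R + b%:R.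
  by rewrite -natrD; apply: (le_trans (ltW yt)); rewrite ler_nat.
have ab' : y <= (n%:R - 1 - a%:R) + (n%:R - 1 - b%:R).
  have -> : (n%:R - 1 - a%:R) + (n%:R - 1 - b%:R) =
      ((n - a.+1) + (n - b.+1))%:R :> R.
    by rewrite natrD !natrB// -!natr1; ring.
  by apply: (le_trans (ltW yt)); rewrite ler_nat.
apply: le_trans (freq_inner_inv R s (l, a, b)) => /=.
rewrite -[leLHS]add0r lerD ?divr_ge0//.
rewrite ler_wpM2r ?invr_ge0 ?mulr_ge0 ?exprn_ge0//.
set N := n%:R - 1 in yn ab' *; move: ab ab'.
set u := a%:R; set w := b%:R => ab ab'.
(* With [z = u + w], [u (N - w) + (N - u) w = z (2 N - z) / 2 + (u - w)^2 / 2],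
   and [z (2 N - z) >= y (2 N - y)] since [y <= z <= 2 N - y]. *)
have := sqr_ge0 (u - w); nra.
Qed.

Lemma measurable_min_inversion_ge (R : realType) (d : measure_display)
    (T : measurableType d) (P : probability T R) (n : nat)
    (Z : 'I_n -> {RV P >-> (R * R)%type}) (t : R) :
  measurable [set w | t <= min_inversion_rv Z w].
Proof.
rewrite (_ : [set w | _] = min_inversion_rv Z @^-1` `[t, +oo[%classic).
  by rewrite -[X in measurable X]setTI; apply: measurable_min_inversion_rv.
by apply/seteqP; split => w /=; rewrite in_itv/= andbT.
Qed.

Lemma measurable_min_inversion_le (R : realType) (d : measure_display)
    (T : measurableType d) (P : probability T R) (n : nat)
    (Z : 'I_n -> {RV P >-> (R * R)%type}) (t : R) :
  measurable [set w | min_inversion_rv Z w <= t].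
Proof.
rewrite (_ : [set w | _] = min_inversion_rv Z @^-1` `]-oo, t]%classic).
  by rewrite -[X in measurable X]setTI; apply: measurable_min_inversion_rv.
by apply/seteqP; split => w /=; rewrite in_itv.
Qed.

(** If the minimum is at least t r, either all points avoid [A], or a point in [A] has at least t r
    hits although at most s0 r are expected. The first alternative gives the power, the second the
    union bound. *)
Lemma min_inversion_ge_tail (R : realType) (s0 t : R) : 0 <= s0 -> s0 < t ->
  exists2 c : R, 0 < c & forall (k n : nat) (s : 'S_k) (d : measure_display)
    (T : measurableType d) (P : probability T R)
    (Z : 'I_n -> {RV P >-> (R * R)%type}) (A : {set box k n}) (r : R),
  (0 < k)%N -> (0 < n)%N -> iid_sample (empirical_permuton s) Z -> 0 <= r ->
  {in A, forall f, freq R (outer_inv s f) * n.-1%:R <= s0 * r} ->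
  (P [set w | (t * r <= min_inversion_rv Z w)%R] <=
   ((1 - freq R A) ^+ n + n%:R * expR (- (c * r)))%:E)%E.
Proof.
move=> s00 s0t; have [c c0 H] := chernoff_upper s00 s0t.
exists c => // k n s d T P Z A r k0 n0 iid r0 Ar.
have F0 : (0 < #|{: box k n}|)%N by rewrite !card_prod !card_ord !muln_gt0 k0 n0.
pose Q (w : {ffun 'I_n -> box k n}) i f :=
  t * r <= (hits w i (outer_inv s f))%:R.
pose W1 := [set w : {ffun 'I_n -> box k n} | [forall i, w i \notin A]]%SET.
pose W2 := [set w : {ffun 'I_n -> box k n} |
  [exists i, (w i \in A) && Q w i (w i)]]%SET.
apply: (@le_trans _ _ (freq R (W1 :|: W2)%SET)%:E).
  apply: (probability_le_freq k0 n0 iid); first exact: measurable_min_inversion_ge.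
  move=> w x wx /= tx; rewrite !inE -implyNb negb_forall; apply/implyP.
  move=> /existsP[i]; rewrite negbK => wiA; apply/existsP; exists i.
  rewrite wiA; apply: (le_trans tx); rewrite ler_nat.
  apply: (leq_trans (min_inversion_le _ i)).
  exact: hits_outer_inv.
rewrite lee_fin; apply: (le_trans (freq_setU _ _ _)).
apply: lerD; first by rewrite freq_avoid.
apply: freq_exists_le; first exact: expR_ge0.
by move=> i f fA; apply: H => //; apply: Ar.
Qed.

(** If the minimum is at most t r, either some point falls in [A], or the minimising point is
    outside [A] and has at most t r hits although at least s0 r are expected. *)
Lemma min_inversion_le_tail (R : realType) (s0 t : R) : 0 <= s0 -> t < s0 ->
  exists2 c : R, 0 < c & forall (k n : nat) (s : 'S_k) (d : measure_display)
    (T : measurableType d) (P : probability T R)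
    (Z : 'I_n -> {RV P >-> (R * R)%type}) (A : {set box k n}) (r : R),
  (0 < k)%N -> (0 < n)%N -> iid_sample (empirical_permuton s) Z -> 0 <= r ->
  (forall f, f \notin A -> s0 * r <= freq R (inner_inv s f) * n.-1%:R) ->
  (P [set w | (min_inversion_rv Z w <= t * r)%R] <=
   (1 - (1 - freq R A) ^+ n + n%:R * expR (- (c * r)))%:E)%E.
Proof.
move=> s00 s0t; have [c c0 H] := chernoff_lower s00 s0t.
exists c => // k n s d T P Z A r k0 n0 iid r0 Ar.
have F0 : (0 < #|{: box k n}|)%N by rewrite !card_prod !card_ord !muln_gt0 k0 n0.
pose Q (w : {ffun 'I_n -> box k n}) i f :=
  (hits w i (inner_inv s f))%:R <= t * r.
pose W1 := (~: [set w : {ffun 'I_n -> box k n} | [forall i, w i \notin A]])%SET.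
pose W2 := [set w : {ffun 'I_n -> box k n} |
  [exists i, (w i \in (~: A)%SET) && Q w i (w i)]]%SET.
apply: (@le_trans _ _ (freq R (W1 :|: W2)%SET)%:E).
  apply: (probability_le_freq k0 n0 iid); first exact: measurable_min_inversion_le.
  move=> w x wx /= tx; rewrite !inE -implyNb negbK; apply/implyP.
  move=> /forallP wA; apply/existsP.
  have [i iE] := min_inversion_attained (fun i => Z i x) n0.
  exists i; rewrite inE wA; apply: le_trans tx; rewrite ler_nat iE.
  exact: hits_inner_inv.
rewrite lee_fin; apply: (le_trans (freq_setU _ _ _)).
apply: lerD.
  by rewrite freq_setC ?freq_avoid// card_ffun expn_gt0 F0.
apply: freq_exists_le; first exact: expR_ge0.
by move=> i f; rewrite inE => fA; apply: H => //; apply: Ar.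
Qed.

(** * Elementary asymptotics *)

Lemma near_mul_expRN_sqrt (R : realType) (c e : R) : 0 < c -> 0 < e ->
  \forall n \near \oo, n%:R * expR (- (c * Num.sqrt n%:R)) <= e.
Proof.
move=> c0 e0.
near=> n.
have n0 : 0 < n%:R :> R by rewrite ltr0n; near: n; exact: nbhs_infty_gt.
have x0 : 0 <= c * Num.sqrt n%:R by rewrite mulr_ge0 ?sqrtr_ge0// ltW.
(* The order-four term of the exponential, c^4 n^2 / 24, already beats n. *)
have := expR_ge1Dxn 3 x0; rewrite exprMn.
have -> : Num.sqrt n%:R ^+ 4 = n%:R ^+ 2 :> R.
  by rewrite (exprM _ 2 2) sqr_sqrtr// ltW.
have -> : 4`!%:R = 24 :> R by [].
move=> H; rewrite expRN ler_pdivrMr ?expR_gt0//.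
apply: (@le_trans _ _ (e * (c ^+ 4 * n%:R ^+ 2 / 24))); last first.
  by rewrite ler_wpM2l ?(ltW e0)//; lra.
have c4 : 0 < c ^+ 4 by rewrite exprn_gt0.
have : 24 / (e * c ^+ 4) <= n%:R.
  near: n; exact: nbhs_infty_ger.
rewrite ler_pdivrMr ?mulr_gt0// => le24.
rewrite -subr_ge0.
have -> : e * (c ^+ 4 * n%:R ^+ 2 / 24) - n%:R = n%:R * (n%:R * (e * c ^+ 4) - 24) / 24.
  by field.
by rewrite divr_ge0// mulr_ge0 ?subr_ge0// ltW.
Unshelve. all: by end_near.
Qed.

Lemma exprn_1B_le (R : realType) (p : R) (n : nat) : p <= 1 ->
  (1 - p) ^+ n <= expR (- (n%:R * p)).
Proof.
move=> p1; have -> : - (n%:R * p) = (- p) * n%:R by ring.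
rewrite expRM_natr lerXn2r ?nnegrE ?expR_ge0 ?subr_ge0//.
exact: expR_ge1Dx.
Qed.

(** 1 / (1 - p) = 1 + p / (1 - p) <= exp(p / (1 - p)), inverted and raised to the power n. *)
Lemma exprn_1B_ge (R : realType) (p : R) (n : nat) : p < 1 ->
  expR (- (n%:R * p / (1 - p))) <= (1 - p) ^+ n.
Proof.
move=> p1; have -> : - (n%:R * p / (1 - p)) = - (p / (1 - p)) * n%:R by ring.
have p10 : 0 < 1 - p by rewrite subr_gt0.
rewrite expRM_natr lerXn2r ?nnegrE ?expR_ge0 ?(ltW p10)//.
rewrite expRN -[leRHS]invrK lef_pV2 ?posrE ?expR_gt0 ?invr_gt0//.
apply: le_trans (expR_ge1Dx _); rewrite le_eqVlt; apply/orP; left; apply/eqP.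
by field; lra.
Qed.

Lemma cvg_sqrtV (R : realType) : (Num.sqrt n%:R)^-1 @[n --> \oo] --> (0 : R).
Proof.
apply/cvgrPdist_le => e e0; near=> n.
have n0 : 0 < n%:R :> R by rewrite ltr0n; near: n; exact: nbhs_infty_gt.
have r0 : 0 < Num.sqrt n%:R :> R by rewrite sqrtr_gt0.
rewrite sub0r normrN ger0_norm ?invr_ge0 ?(ltW r0)//.
rewrite -[leRHS]invrK lef_pV2 ?posrE ?invr_gt0//.
have -> : e^-1 = Num.sqrt (e^-1 ^+ 2) by rewrite sqrtr_sqr ger0_norm// invr_ge0 ltW.
by rewrite ler_wsqrtr//; near: n; exact: nbhs_infty_ger.
Unshelve. all: by end_near.
Qed.

Lemma continuous_expRN_sqr (R : realType) (b : R) :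
  continuous (fun s : R => expR (- (b * s ^+ 2))).
Proof.
move=> s; apply: continuous_comp; last exact: continuous_expR.
by apply: cvgN; apply: cvgMl_tmp; apply: cvgM; exact: cvg_id.
Qed.

Lemma cvgn_comp_expR (R : realType) (f : nat -> R) (l : R) :
  f n @[n --> \oo] --> l -> expR (f n) @[n --> \oo] --> expR l.
Proof. by move=> fl; apply: continuous_cvg => //; exact: continuous_expR. Qed.

Lemma near_sqrt_gt (R : realType) (x : R) :
  \forall n \near \oo, x < Num.sqrt n%:R.
Proof.
near=> n; apply: (le_lt_trans (ler_norm x)).
rewrite -[ltLHS]ger0_norm// -sqrtr_sqr ltr_sqrt.
  by near: n; exact: nbhs_infty_gtr.
by rewrite ltr0n; near: n; exact: nbhs_infty_gt.
Unshelve. all: by end_near.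
Qed.

Lemma splittings_inv0 (k : nat) (s : 'S_k) :
  {in splittings s, forall l, #|inversions (perm_points s) l| = 0%N}.
Proof. by move=> l; rewrite inE => /eqP ->; rewrite cards0. Qed.

(** * Asymptotic tails of the minimal inversion at scales sqrt n and n *)

Section tails.
Context (R : realType) (k : nat) (s : 'S_k).
Context (d : nat -> measure_display) (T : forall n, measurableType (d n)).
Context (P : forall n, probability (T n) R).
Context (Z : forall n, 'I_n -> {RV (P n) >-> (R * R)%type}).
Context (k0 : (0 < k)%N)
  (hZ : forall n, iid_sample (empirical_permuton s) (@Z n)).

Let b : R := (k * #|splittings s|)%:R.

Lemma sqrt_tail_le (t e : R) : 0 <= t -> 0 < e ->
  \forall n \near \oo,
    (P n [set w | (t * Num.sqrt n%:R <= min_inversion_rv (@Z n) w)%R] <=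
     (expR (- (b * t ^+ 2)) + e)%:E)%E.
Proof.
move=> t0 e0; have k0' : 0 < k%:R :> R by rewrite ltr0n.
(* At t = 0 there is no room for a positive x < t, but the bound is at least 1. *)
have [t_eq0|t_neq0] := eqVneq t 0.
  near=> n; apply: (le_trans (probability_le1 _ _)).
    exact: measurable_min_inversion_ge.
  by rewrite lee_fin t_eq0 expr0n mulr0 oppr0 expR0 lerDl ltW.
have tp : 0 < t by rewrite lt_neqAle eq_sym t_neq0.
have e4 : 0 < e / 4 by rewrite divr_gt0.
have [x [x0 xt xe]] : exists x : R,
    [/\ 0 < x, x < t & expR (- (b * x ^+ 2)) <= expR (- (b * t ^+ 2)) + e / 4].
  have /cvg_at_left_filter/cvgrPdist_le/(_ _ e4) H := @continuous_expRN_sqr R b t.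
  near t^'- => x; exists x; split.
  - by near: x; exact: nbhs_left_gt.
  - by near: x; exact: nbhs_left_lt.
  have : `|expR (- (b * t ^+ 2)) - expR (- (b * x ^+ 2))| <= e / 4 by near: x.
  by rewrite ler_norml => /andP[]; lra.
have [c c0 tailc] := min_inversion_ge_tail (ltW x0) xt.
set D := splittings s.
(* With u = 1 / sqrt n and corner side X = x k sqrt n, this bounds the probability of an empty
   corner: [p] satisfies p >= X - 2 and p + 1 >= X - 1, whence the two factors. *)
pose G (u : R) := expR (- (#|D|%:R / k%:R * ((x * k%:R - 2 * u) * (x * k%:R - u)))).
have G0 : G 0 = expR (- (b * x ^+ 2)).
  by rewrite /G /b natrM -/D; congr (expR (- _)); field; rewrite gt_eqF.
have cG : G (Num.sqrt n%:R)^-1 @[n --> \oo] --> G 0.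
  rewrite /G; apply: cvgn_comp_expR; apply: cvgN; apply: cvgMl_tmp.
  apply: cvgM; apply: cvgB; try exact: cvg_cst.
    by apply: cvgMl_tmp; exact: cvg_sqrtV.
  exact: cvg_sqrtV.
move/cvgrPdist_le : cG => /(_ _ e4); rewrite G0 => cG.
have ne := near_mul_expRN_sqrt c0 e4.
near=> n.
have n0 : (0 < n)%N by near: n; exact: nbhs_infty_gt.
have : `|expR (- (b * x ^+ 2)) - G (Num.sqrt n%:R)^-1| <= e / 4 by near: n.
have : n%:R * expR (- (c * Num.sqrt n%:R)) <= e / 4 by near: n.
have : 2 / (x * k%:R) < Num.sqrt n%:R by near: n; exact: near_sqrt_gt.
have : x * k%:R < Num.sqrt n%:R by near: n; exact: near_sqrt_gt.
set r : R := Num.sqrt n%:R => rk r2 ne' cG'.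
have r0 : 0 < r by rewrite sqrtr_gt0 ltr0n.
have nr : n%:R = r ^+ 2 by rewrite sqr_sqrtr.
pose X := x * k%:R * r.
have X2 : 2 < X by rewrite /X -ltr_pdivrMl// ?mulr_gt0// mulrC.
set p := (Num.trunc X).-1.
have t1 : (1 <= Num.trunc X)%N by rewrite truncn_ge_nat; lra.
have pE : (Num.trunc X)%:R = p%:R + 1 :> R by rewrite natr1 prednK.
have pX : p%:R + 1 <= X by rewrite -pE truncn_le; lra.
have Xp : X < p%:R + 2.
  by have := truncnS_gt X; rewrite -natr1 pE; lra.
have pn : (p < n)%N.
  rewrite -(ltr_nat R) nr; apply: (@lt_trans _ _ X); first lra.
  by rewrite /X expr2 ltr_pM2r.
have fA := @freq_corner_boxes R k n D p pn.
apply: le_trans (tailc k n s _ _ (P n) (@Z n) (corner_boxes n D p) r k0 n0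
  (hZ n) (ltW r0) _) _.
  move=> f fA'; apply: (le_trans (outer_corner_le (@splittings_inv0 _ s) fA')).
  rewrite mul0r add0r /X ler_pdivrMr//; lra.
rewrite lee_fin.
have := exprn_1B_le n (freq_le1 R (corner_boxes n D p)); rewrite fA => H.
suff HG : expR (- (n%:R * (#|D|%:R * (p%:R * (p%:R + 1)) /
    (k%:R * n%:R ^+ 2)))) <= G r^-1.
  by move: cG' HG; set g := G _; rewrite ler_norml => /andP[] *; lra.
rewrite ler_expR lerN2 nr.
have -> : #|D|%:R / k%:R * ((x * k%:R - 2 * r^-1) * (x * k%:R - r^-1)) =
    #|D|%:R / (k%:R * r ^+ 2) * ((X - 2) * (X - 1)).
  by rewrite /X; field; rewrite !gt_eqF.
have -> : r ^+ 2 * (#|D|%:R * (p%:R * (p%:R + 1)) / (k%:R * (r ^+ 2) ^+ 2)) =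
    #|D|%:R / (k%:R * r ^+ 2) * (p%:R * (p%:R + 1)).
  by field; rewrite !gt_eqF.
rewrite ler_wpM2l ?divr_ge0 ?mulr_ge0 ?exprn_ge0 ?(ltW r0)//.
by apply: ler_pM; lra.
Unshelve. all: by end_near.
Qed.

Lemma le_sqrt_tail (t e : R) : 0 <= t -> 0 < e ->
  \forall n \near \oo,
    (P n [set w | (min_inversion_rv (@Z n) w <= t * Num.sqrt n%:R)%R] <=
     (1 - expR (- (b * t ^+ 2)) + e)%:E)%E.
Proof.
move=> t0 e0; have k0' : 0 < k%:R :> R by rewrite ltr0n.
have e4 : 0 < e / 4 by rewrite divr_gt0.
have [x tx xe] : exists2 x : R,
    t < x & expR (- (b * t ^+ 2)) - e / 4 <= expR (- (b * x ^+ 2)).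
  have /cvg_at_right_filter/cvgrPdist_le/(_ _ e4) H := @continuous_expRN_sqr R b t.
  near t^'+ => x; exists x.
    by near: x; exact: nbhs_right_gt.
  have : `|expR (- (b * t ^+ 2)) - expR (- (b * x ^+ 2))| <= e / 4 by near: x.
  by rewrite ler_norml => /andP[]; lra.
have x0 : 0 < x by lra.
(* Two gaps are needed: from [t] to [x'] for the exponential bound, and from [x'] to [x] to absorb
   the lower-order terms in [H1]. *)
pose x' := (t + x) / 2.
have [c c0 tailc] : exists2 c : R, 0 < c & _ :=
  @min_inversion_le_tail R x' t ltac:(rewrite /x'; lra) ltac:(rewrite /x'; lra).
set D := splittings s.
(* With u = 1 / sqrt n and Y = x k sqrt n, n times the corner mass is at most [v u], because p <= Y
   + 1; hence u^2 [v u] bounds the corner mass itself. *)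
pose v (u : R) := #|D|%:R / k%:R * ((x * k%:R + u) * (x * k%:R + 2 * u)).
pose G (u : R) := expR (- (v u / (1 - u ^+ 2 * v u))).
(* [H1] times sqrt n is the expected-count bound of [inner_off_corner_ge] in splitting cells.
   Nonnegativity of [H2] says that (n - 1) / k, available in a cell with at least one inversion, is
   at least x' sqrt n. *)
pose H1 (u : R) := x * (1 - u ^+ 2) ^+ 2 - x ^+ 2 * k%:R * (1 - u ^+ 2) * u / 2.
pose H2 (u : R) := 1 - u ^+ 2 - x' * k%:R * u.
have cu := @cvg_sqrtV R.
have cu2 : (Num.sqrt n%:R)^-1 ^+ 2 @[n --> \oo] --> (0 ^+ 2 : R).
  by apply: cvgM; exact: cvg_sqrtV.
have c1u2 : 1 - (Num.sqrt n%:R)^-1 ^+ 2 @[n --> \oo] --> (1 - 0 ^+ 2 : R).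
  by apply: cvgB; [exact: cvg_cst|].
have cv : v (Num.sqrt n%:R)^-1 @[n --> \oo] --> v 0.
  apply: cvgMl_tmp; apply: cvgM; apply: cvgD; try exact: cvg_cst; first exact: cu.
  by apply: cvgMl_tmp.
have cu2v : 1 - (Num.sqrt n%:R)^-1 ^+ 2 * v (Num.sqrt n%:R)^-1 @[n --> \oo] -->
    1 - 0 ^+ 2 * v 0.
  by apply: cvgB; [exact: cvg_cst|apply: cvgM].
have cG : G (Num.sqrt n%:R)^-1 @[n --> \oo] --> G 0.
  apply: cvgn_comp_expR; apply: cvgN; apply: cvgM => //.
  by apply: cvgV => //; rewrite expr0n mul0r subr0 oner_neq0.
have cH1 : H1 (Num.sqrt n%:R)^-1 @[n --> \oo] --> H1 0.
  apply: cvgB; first by apply: cvgMl_tmp; apply: cvgM.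
  apply: cvgMr_tmp; apply: cvgM => //.
  by apply: cvgMl_tmp.
have cH2 : H2 (Num.sqrt n%:R)^-1 @[n --> \oo] --> H2 0.
  by apply: cvgB => //; apply: cvgMl_tmp.
have G0 : G 0 = expR (- (b * x ^+ 2)).
  rewrite /G /v /b natrM -/D; congr (expR (- _)); field.
  by rewrite gt_eqF//= expr0n !mul0r oner_neq0.
have nG : \forall n \near \oo, `|G 0 - G (Num.sqrt n%:R)^-1| <= e / 4.
  by move/cvgrPdist_le : cG; apply.
have nH1 : \forall n \near \oo, x' <= H1 (Num.sqrt n%:R)^-1.
  have xx : x' < H1 0 by rewrite /H1 /x'; lra.
  by move/cvgr_ge : cH1 => /(_ _ xx).
have nH2 : \forall n \near \oo, 0 <= H2 (Num.sqrt n%:R)^-1.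
  have xx : 0 < H2 0 by rewrite /H2; lra.
  by move/cvgr_ge : cH2 => /(_ _ xx).
have nv : \forall n \near \oo, 0 < 1 - (Num.sqrt n%:R)^-1 ^+ 2 * v (Num.sqrt n%:R)^-1.
  have xx : 0 < 1 - 0 ^+ 2 * v 0 by rewrite expr0n mul0r; lra.
  by move/cvgr_gt : cu2v => /(_ _ xx).
have ne := near_mul_expRN_sqrt c0 e4.
near=> n.
have n0 : (0 < n)%N by near: n; exact: nbhs_infty_gt.
have : `|G 0 - G (Num.sqrt n%:R)^-1| <= e / 4 by near: n.
have : x' <= H1 (Num.sqrt n%:R)^-1 by near: n.
have : 0 <= H2 (Num.sqrt n%:R)^-1 by near: n.
have : 0 < 1 - (Num.sqrt n%:R)^-1 ^+ 2 * v (Num.sqrt n%:R)^-1 by near: n.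
have : n%:R * expR (- (c * Num.sqrt n%:R)) <= e / 4 by near: n.
have : x * k%:R + 1 < Num.sqrt n%:R by near: n; exact: near_sqrt_gt.
have : 1 < Num.sqrt n%:R :> R by near: n; exact: near_sqrt_gt.
set r : R := Num.sqrt n%:R => r1 rk ne' nv' nH2' nH1' nG'.
have r0 : 0 < r by rewrite sqrtr_gt0 ltr0n.
have nr : n%:R = r ^+ 2 by rewrite sqr_sqrtr.
pose Y := x * k%:R * r.
have xk0 : 0 < x * k%:R by rewrite mulr_gt0.
have Y0 : 0 <= Y by rewrite /Y mulr_ge0 ?(ltW xk0) ?(ltW r0).
set p := (Num.trunc Y).+1.
have pY : p%:R <= Y + 1 by rewrite /p -natr1 lerD2r truncn_le.
have Yp : Y < p%:R by exact: truncnS_gt.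
have pn : (p < n)%N.
  rewrite -(ltr_nat R) nr; apply: (le_lt_trans pY).
  apply: (@lt_trans _ _ ((x * k%:R + 1) * r)); first by rewrite mulrDl mul1r ltrD2l.
  by rewrite expr2 ltr_pM2r.
have Yn : Y <= n%:R - 1.
  rewrite lerBrDr; apply: (@le_trans _ _ p.+1%:R); last by rewrite ler_nat.
  by rewrite -[p.+1%:R]natr1; lra.
have fA := @freq_corner_boxes R k n D p pn.
set q := freq R (corner_boxes n D p) in fA.
have qv : n%:R * q <= v r^-1.
  rewrite fA nr.
  have -> : r ^+ 2 * (#|D|%:R * (p%:R * (p%:R + 1)) / (k%:R * (r ^+ 2) ^+ 2)) =
      #|D|%:R / (k%:R * r ^+ 2) * (p%:R * (p%:R + 1)).
    by field; rewrite !gt_eqF.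
  have -> : v r^-1 = #|D|%:R / (k%:R * r ^+ 2) * ((Y + 1) * (Y + 2)).
    by rewrite /v /Y; field; rewrite !gt_eqF.
  rewrite ler_wpM2l ?divr_ge0 ?mulr_ge0 ?exprn_ge0 ?(ltW r0)//.
  by apply: ler_pM; lra.
have q0 : 0 <= q by exact: freq_ge0.
have qv2 : q <= r^-1 ^+ 2 * v r^-1.
  by rewrite exprVn -nr ler_pdivlMl ?ltr0n.
have q1 : 0 < 1 - q by lra.
apply: le_trans (tailc k n s _ _ (P n) (@Z n) (corner_boxes n D p) r k0 n0
  (hZ n) (ltW r0) _) _.
  move=> f fA'.
  have n1E : n.-1%:R = n%:R - 1 :> R by rewrite -[in RHS](prednK n0) -natr1 addrK.
  have n1 : 0 <= n%:R - 1 :> R by rewrite -n1E.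
  rewrite n1E.
  have [fD|fD] := boolP (f.1.1 \in D).
    have := inner_off_corner_ge Y0 Yn fD fA' => /(ler_wpM2r n1); apply: le_trans.
    have -> : (Y * (n%:R - 1) - Y ^+ 2 / 2) / (k%:R * n%:R ^+ 2) * (n%:R - 1) =
        H1 r^-1 * r.
      by rewrite /H1 /Y nr; field; rewrite !gt_eqF.
    by rewrite ler_wpM2r// ltW.
  have inv1 : 1 <= #|inversions (perm_points s) f.1.1|%:R :> R.
    by rewrite ler1n card_gt0; move: fD; rewrite inE.
  apply: (@le_trans _ _ (1 / k%:R * (n%:R - 1))); last first.
    rewrite ler_wpM2r//; apply: le_trans (inner_inv_ge R s f).
    by rewrite ler_wpM2r ?invr_ge0 ?(ltW k0').
  rewrite mul1r [leRHS]mulrC ler_pdivlMr// nr.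
  have : 0 <= H2 r^-1 * r ^+ 2 by rewrite mulr_ge0 ?sqr_ge0.
  have -> : H2 r^-1 * r ^+ 2 = r ^+ 2 - 1 - x' * k%:R * r.
    by rewrite /H2; field; rewrite gt_eqF.
  by lra.
rewrite lee_fin -/q.
have H := @exprn_1B_ge R q n ltac:(lra).
suff HG : G r^-1 <= expR (- (n%:R * q / (1 - q))).
  move: nG' HG H; rewrite G0; set g := G _; rewrite ler_norml => /andP[] *; lra.
rewrite ler_expR lerN2; apply: ler_pM.
- by rewrite mulr_ge0.
- by rewrite invr_ge0 ltW.
- exact: qv.
- by rewrite lef_pV2 ?posrE//; lra.
Unshelve. all: by end_near.
Qed.

Let c : R := (min_inversion (perm_points s))%:R / k%:R.

Let ler_mul_expRN (a e : R) (n : nat) : 0 < a -> (0 < n)%N ->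
  n%:R * expR (- (a * Num.sqrt n%:R)) <= e -> n%:R * expR (- (a * n%:R)) <= e.
Proof.
move=> a0 n0; apply: le_trans; rewrite ler_wpM2l// ler_expR lerN2 ler_wpM2l ?(ltW a0)//.
rewrite -[leRHS]ger0_norm// -sqrtr_sqr ler_wsqrtr// -natrX ler_nat.
by rewrite expnS expn1 leq_pmulr.
Qed.

Lemma linear_tail_le (e e' : R) : 0 < e -> 0 < e' ->
  \forall n \near \oo,
    (P n [set w | ((c + e) * n%:R <= min_inversion_rv (@Z n) w)%R] <= e'%:E)%E.
Proof.
move=> e0 e'0; have k0' : 0 < k%:R :> R by rewrite ltr0n.
have c0 : 0 <= c by rewrite divr_ge0.
have [a a0 taila] := @min_inversion_ge_tail R (c + e / 2) (c + e)
  ltac:(lra) ltac:(lra).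
have [l lE] := min_inversion_attained (perm_points s) k0.
(* Relative side of the corner triangles in a cell [l] with fewest inversions: the first bound keeps
   the expected count below (c + e / 2) n, the second keeps the triangles inside the cell. *)
pose th : R := Num.min (e * k%:R / 2) 2^-1.
have th0 : 0 < th by rewrite lt_min divr_gt0 ?mulr_gt0//= invr_gt0.
have th1 : th <= 2^-1 by rewrite ge_min lexx orbT.
have the : th <= e * k%:R / 2 by rewrite ge_min lexx.
(* Lower bound for the corner mass p (p + 1) / (k n^2): once th n >= 4, both p and p + 1 are at
   least th n / 2. *)
pose dl := th ^+ 2 / (4 * k%:R).
have dl0 : 0 < dl by rewrite divr_gt0 ?exprn_gt0// mulr_gt0.
have e'2 : 0 < e' / 2 by rewrite divr_gt0.
have n1 := near_mul_expRN_sqrt a0 e'2.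
have n2 := near_mul_expRN_sqrt dl0 e'2.
near=> n.
have n0 : (0 < n)%N by near: n; exact: nbhs_infty_gt.
have n0' : 0 < n%:R :> R by rewrite ltr0n.
have m1 : n%:R * expR (- (a * n%:R)) <= e' / 2 by apply: ler_mul_expRN => //; near: n.
have m2 : n%:R * expR (- (dl * n%:R)) <= e' / 2 by apply: ler_mul_expRN => //; near: n.
have n4 : 4 / th <= n%:R by near: n; exact: nbhs_infty_ger.
pose X := th * n%:R.
have X4 : 4 <= X by move: n4; rewrite ler_pdivrMr// mulrC.
set p := (Num.trunc X).-1.
have t1 : (1 <= Num.trunc X)%N by rewrite truncn_ge_nat; lra.
have pE : (Num.trunc X)%:R = p%:R + 1 :> R by rewrite natr1 prednK.
have pX : p%:R + 1 <= X by rewrite -pE truncn_le; lra.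
have Xp : X < p%:R + 2.
  by have := truncnS_gt X; rewrite -natr1 pE; lra.
have XN : X <= n%:R.
  by rewrite /X ler_piMl ?(ltW n0')//; lra.
have pn : (p < n)%N by rewrite -(ltr_nat R); lra.
have fA := @freq_corner_boxes R k n [set l]%SET p pn.
apply: le_trans (taila k n s _ _ (P n) (@Z n) (corner_boxes n [set l]%SET p)
  n%:R k0 n0 (hZ n) (ltW n0') _) _.
  have lv : {in [set l]%SET, forall l', #|inversions (perm_points s) l'| =
      min_inversion (perm_points s)}.
    by move=> l'; rewrite inE => /eqP ->.
  move=> f fA'; apply: le_trans (outer_corner_le lv fA') _.
  rewrite /X mulrDl mulrDl /c; rewrite mulrAC lerD2l mulrAC ler_wpM2r ?(ltW n0')//.
  by rewrite ler_pdivrMr//; lra.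
rewrite lee_fin; have H := exprn_1B_le n (freq_le1 R (corner_boxes n [set l]%SET p)).
suff HA : dl <= freq R (corner_boxes n [set l]%SET p).
  have : expR (- (n%:R * freq R (corner_boxes n [set l]%SET p))) <=
      n%:R * expR (- (dl * n%:R)).
    apply: (@le_trans _ _ (expR (- (dl * n%:R)))).
      by rewrite ler_expR lerN2 mulrC ler_wpM2l ?(ltW n0').
    by rewrite ler_peMl ?expR_ge0// ler1n.
  by move: H m1 m2; set u := _ ^+ n; set v := expR _; lra.
rewrite fA cards1 mul1r ler_pdivlMr ?mulr_gt0 ?exprn_gt0//.
have -> : dl * (k%:R * n%:R ^+ 2) = (X / 2) * (X / 2).
  by rewrite /dl /X; field; rewrite gt_eqF.
by apply: ler_pM; lra.
Unshelve. all: by end_near.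
Qed.

Lemma le_linear_tail (e e' : R) : splittings s = finset.set0 -> 0 < e -> 0 < e' ->
  \forall n \near \oo,
    (P n [set w | (min_inversion_rv (@Z n) w <= (c - e) * n%:R)%R] <= e'%:E)%E.
Proof.
move=> D0 e0 e'0; have k0' : 0 < k%:R :> R by rewrite ltr0n.
(* This is where the absence of splittings enters; it leaves room for a nonnegative [s0] below
   [c]. *)
have c0 : 0 < c.
  rewrite divr_gt0// ltr0n; have [l ->] := min_inversion_attained (perm_points s) k0.
  rewrite card_gt0; apply/negP => /eqP l0.
  have : l \in splittings s by rewrite inE l0.
  by rewrite D0 inE.
(* The maximum with 0 covers c < e / 2, and the strict gap to [c] pays for replacing n - 1 by n. *)
pose s0 : R := Num.max (c - e / 2) 0.
have s00 : 0 <= s0 by rewrite le_max lexx orbT.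
have s0e : c - e < s0 by rewrite lt_max; apply/orP; left; lra.
have s0c : s0 < c by rewrite gt_max c0 andbT; lra.
have [a a0 taila] := min_inversion_le_tail s00 s0e.
have n1 := near_mul_expRN_sqrt a0 e'0.
near=> n.
have n0 : (0 < n)%N by near: n; exact: nbhs_infty_gt.
have n0' : 0 < n%:R :> R by rewrite ltr0n.
have m1 : n%:R * expR (- (a * n%:R)) <= e' by apply: ler_mul_expRN => //; near: n.
have n4 : c / (c - s0) <= n%:R by near: n; exact: nbhs_infty_ger.
apply: le_trans (taila k n s _ _ (P n) (@Z n) finset.set0 n%:R k0 n0
  (hZ n) (ltW n0') _) _.
  move=> f _; apply: (@le_trans _ _ (c * n.-1%:R)).
    have -> : n.-1%:R = n%:R - 1 :> R by rewrite -[in RHS](prednK n0) -natr1 addrK.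
    by move: n4; rewrite ler_pdivrMr ?subr_gt0//; lra.
  rewrite ler_wpM2r//; apply: le_trans (inner_inv_ge R s f).
  by rewrite ler_wpM2r ?invr_ge0 ?(ltW k0')// ler_nat min_inversion_le.
by rewrite lee_fin /freq cards0 mul0r subr0 expr1n subrr add0r.
Unshelve. all: by end_near.
Qed.

Lemma cvg_in_probability_linear (X : forall n, {RV (P n) >-> R}) :
  (forall n w, X n w = n%:R^-1 * min_inversion_rv (@Z n) w) ->
  splittings s = finset.set0 -> cvg_in_probability X c.
Proof.
move=> XE D0 e e0.
have mX n : measurable [set w | e < `|X n w - c|].
  rewrite (_ : [set w | _] = (fun w => `|X n w - c|) @^-1` `]e, +oo[%classic).
    have : measurable_fun setT (fun w => `|X n w - c|).
      by apply: measurableT_comp => //; apply: measurable_funB.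
    by move=> H; rewrite -[X in measurable X]setTI; apply: H.
  by apply/seteqP; split => w /=; rewrite in_itv/= andbT.
apply/fine_cvgP; split.
  by near=> n; apply: fin_num_measure.
suff H (e' : R) : 0 < e' -> \forall n \near \oo,
    `|0 - fine (P n [set w | e < `|X n w - c|])| <= e'.
  by apply/cvgrPdist_le => e'; apply: H.
move=> e'0; have e'2 : 0 < e' / 2 by rewrite divr_gt0.
have n1 := linear_tail_le e0 e'2; have n2 := le_linear_tail D0 e0 e'2.
near=> n.
have n0 : 0 < n%:R :> R by rewrite ltr0n; near: n; exact: nbhs_infty_gt.
rewrite sub0r normrN ger0_norm ?fine_ge0// -lee_fin fineK ?fin_num_measure//.
apply: (@le_trans _ _ (P n
    ([set w | ((c + e) * n%:R <= min_inversion_rv (@Z n) w)%R] `|`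
     [set w | (min_inversion_rv (@Z n) w <= (c - e) * n%:R)%R]))).
  apply: le_measure; rewrite ?inE//.
    by apply: measurableU;
      [exact: measurable_min_inversion_ge|exact: measurable_min_inversion_le].
  move=> w /=; rewrite XE ltr_normr => /orP[]; [left|right].
    by rewrite -ler_pdivlMr// mulrC; lra.
  by rewrite -ler_pdivrMr// mulrC; lra.
apply: (le_trans (measureU2 _ _ _)) => //.
- exact: measurable_min_inversion_ge.
- exact: measurable_min_inversion_le.
have -> : e'%:E = ((e' / 2)%:E + (e' / 2)%:E)%E by rewrite -EFinD; congr EFin; lra.
by apply: leeD; near: n.
Unshelve. all: by end_near.
Qed.

(** [sqrt_tail_le] bounds the event X n > t from above and [le_sqrt_tail] its complement, which
    together give the limit of the tails. *)
Lemma cvg_in_law_sqrt (X : forall n, {RV (P n) >-> R}) (nu : probability R R) :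
  (forall n w, X n w = (Num.sqrt n%:R)^-1 * min_inversion_rv (@Z n) w) ->
  is_rayleigh 2 (k * #|splittings s|)%:R nu -> cvg_in_law X nu.
Proof.
move=> XE [_ nut]; rewrite -/b in nut.
have nuE t : 0 <= t -> tail nu t = expR (- (b * t ^+ 2)).
  by move=> t0; rewrite /tail nut// powR_mulrn.
apply: cvg_in_lawP => f cf bf; apply: cvg_Rintegral_of_tail => //; last first.
  by rewrite nut// powR0 ?mulr0 ?oppr0 ?expR0.
move=> t t0; rewrite nuE//.
suff H (e : R) : 0 < e -> \forall n \near \oo,
    `|expR (- (b * t ^+ 2)) - tail (distribution (P n) (X n)) t| <= e.
  by apply/cvgrPdist_le => e; apply: H.
move=> e0.
have n1 := sqrt_tail_le t0 e0; have n2 := le_sqrt_tail t0 e0.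
near=> n.
have r0 : 0 < Num.sqrt n%:R :> R.
  by rewrite sqrtr_gt0 ltr0n; near: n; exact: nbhs_infty_gt.
set B := [set w | t < X n w].
have mB : measurable B.
  rewrite (_ : B = X n @^-1` `]t, +oo[%classic).
    by rewrite -[X in measurable X]setTI; apply: (measurable_funP (X n)).
  by apply/seteqP; split => w /=; rewrite in_itv/= andbT.
have -> : tail (distribution (P n) (X n)) t = fine (P n B).
  rewrite /tail; congr (fine (P n _)).
  by apply/seteqP; split => w /=; rewrite in_itv/= andbT.
have BE : ~` B = [set w | min_inversion_rv (@Z n) w <= t * Num.sqrt n%:R].
  apply/seteqP; split => w; rewrite /B/= XE.
    by move/negP; rewrite -leNgt ler_pdivrMl// mulrC.
  by move=> h; apply/negP; rewrite -leNgt ler_pdivrMl// mulrC.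
have H1 : (P n B <= (expR (- (b * t ^+ 2)) + e)%:E)%E.
  apply: (@le_trans _ _ (P n
    [set w | (t * Num.sqrt n%:R <= min_inversion_rv (@Z n) w)%R])).
    apply: le_measure; rewrite ?inE//.
      exact: measurable_min_inversion_ge.
    by move=> w; rewrite /B/= XE ltr_pdivlMl// mulrC => /ltW.
  by near: n.
have H2 : (P n (~` B) <= (1 - expR (- (b * t ^+ 2)) + e)%:E)%E.
  by rewrite BE; near: n.
move: H1 H2; rewrite probability_setC//.
rewrite -(fineK (fin_num_measure (P n) B mB)) -EFinB !lee_fin.
by rewrite /=; set u := fine _; set v := expR _ => H1 H2; rewrite ler_norml;
  apply/andP; split; lra.
Unshelve. all: by end_near.
Qed.

End tails.

Lemma splittings1 (k : nat) : splittings (1%g : 'S_k) = [set: 'I_k]%SET.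
Proof.
apply/setP => l; rewrite !inE; apply/eqP/setP => m.
by rewrite mem_inversions_perm !perm1 inE; lia.
Qed.

Lemma min_inversion_anti_identity (k : nat) : (0 < k)%N ->
  min_inversion (perm_points (anti_identity k)) = k.-1.
Proof.
move=> k0; have [l ->] := min_inversion_attained (perm_points (anti_identity k)) k0.
have -> : inversions (perm_points (anti_identity k)) l = (~: [set l])%SET.
  apply/setP => m; rewrite mem_inversions_perm !permE !inE -(inj_eq val_inj)/=.
  by have := ltn_ord l; have := ltn_ord m; lia.
by rewrite cardsC1 card_ord.
Qed.

Theorem corollary1p5 (R : realType) (k : nat) (hk : (0 < k)%N) (s : 'S_k)
    (d : nat -> measure_display) (T : forall n, measurableType (d n))
    (P : forall n, probability (T n) R)
    (Z : forall n, 'I_n -> {RV (P n) >-> (R * R)%type})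
    (hZ : forall n, iid_sample (empirical_permuton s) (Z n)) :
  let I_sqrt n : {RV (P n) >-> R} :=
    (Num.sqrt n%:R)^-1 *: (min_inversion_rv (Z n) : {mfun T n >-> R}) in
  let I_lin n : {RV (P n) >-> R} :=
    n%:R^-1 *: (min_inversion_rv (Z n) : {mfun T n >-> R}) in
  let c : R := (min_inversion (perm_points s))%:R / k%:R in
  let c_anti : R := (k%:R - 1) / k%:R in
  [/\ splittings s != finset.set0 ->
        exists2 nu : probability R R,
          is_rayleigh 2 (k * #|splittings s|)%:R nu & cvg_in_law I_sqrt nu,
      s = 1%g ->
        exists2 nu : probability R R,
          is_rayleigh 2 (k ^ 2)%:R nu & cvg_in_law I_sqrt nu
    & splittings s = finset.set0 ->
        [/\ cvg_in_law I_lin \d_c,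
            cvg_in_probability I_lin c
          & s = anti_identity k ->
              cvg_in_law I_lin \d_c_anti /\ cvg_in_probability I_lin c_anti]].
Proof.
move=> I_sqrt I_lin c c_anti.
have rayleigh : splittings s != finset.set0 -> exists2 nu : probability R R,
    is_rayleigh 2 (k * #|splittings s|)%:R nu & cvg_in_law I_sqrt nu.
  rewrite -card_gt0 => D0.
  have [|nu hnu] := @exists_rayleigh R (k * #|splittings s|)%:R.
    by rewrite ltr0n muln_gt0 hk.
  by exists nu => //; apply: (cvg_in_law_sqrt hk hZ).
split => // [s1|D0].
  have DT : splittings s = [set: 'I_k]%SET by rewrite s1 splittings1.
  have := rayleigh; rewrite DT cardsT card_ord expnS expn1; apply.
  by rewrite -card_gt0 cardsT card_ord.
have lin : cvg_in_probability I_lin c by apply: (cvg_in_probability_linear hk hZ).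
split=> //; first exact: cvg_in_probability_law.
move=> sE; have cE : c_anti = c.
  rewrite /c_anti /c sE min_inversion_anti_identity//.
  have -> // : k.-1%:R = k%:R - 1 :> R by rewrite -[in RHS](prednK hk) -natr1 addrK.
by rewrite cE; split => //; exact: cvg_in_probability_law.
Qed.
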